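(* Let $d\in\mathbb{N}$, $p$ a kernel and $\xi$ noise as in the context. Then for every $u\in\mathcal{H}_d$ the measure $\pi_u$ is an extreme point of $\mathcal{I}$. Moreover, for any $\nu\in\mathcal{I}$ under which each $\eta(x-e_i,x)$ has finite mean and variance, \[\mathrm{Var}^\nu[\eta(x-e_i,x)]\ge\mathrm{Var}^{\pi_0}[\eta(x-e_i,x)]\quad\text{for all }x\in\mathbb{Z}^d,\ i\in\{1,\dots,d\},\] and equality holds for all $i$ and $x$ if and only if $\nu\in\{\pi_u:u\in\mathcal{H}_d\}$.
   Context: The kernel $p:\mathbb{Z}^d\to[0,1)$ satisfies $\sum_x p(x)=1$, $p(x)=0$ for $|x|>M$ for some $M<\infty$, and strong aperiodicity: for every $u\in\mathbb{Z}^d$ the smallest additive subgroup of $\mathbb{Z}^d$ containing $\{u+x:p(x)>0\}$ is $\mathbb{Z}^d$; $p(x,y)=p(y-x)$ and $p^k$ is the $k$-step transition. $\xi=\{\xi_t(x)\}_{t\in\mathbb{Z},x\in\mathbb{Z}^d}$ are i.i.d. real, mean zero, finite variance. The increment process is the Markov chain on $(\mathbb{R}^d)^{\mathbb{Z}^d}$, with configurations $\eta=\{\eta(x)\}_x$, $\eta(x)=(\eta(x-e_i,x))_{i=1}^d$, evolving by $\eta_{t+1}(x-e_i,x)=\sum_z p(0,z)\eta_t(x+z-e_i,x+z)+\xi_{t+1}(x)-\xi_{t+1}(x-e_i)$ with $\xi_{t+1}$ independent of $\eta_t$ (no additivity is required). $\mathcal{I}$ is the set of probability measures on $(\mathbb{R}^d)^{\mathbb{Z}^d}$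 invariant for this chain. $\Delta_0(x-e_i,x)=\sum_{k\ge 0}\sum_z\xi_{-k}(z)(p^k(x,z)-p^k(x-e_i,z))$ (convergent a.s. and in $L^2$). A function $v:\mathbb{Z}^d\to\mathbb{R}$ is harmonic if $\sum_y p(x,y)v(y)=v(x)$ for all $x$; $\mathcal{H}_d$ is the set of $u=(u_1,\dots,u_d)$ with each $u_i:\mathbb{Z}^d\to\mathbb{R}$ harmonic. For $u\in\mathcal{H}_d$, $\pi_u$ is the law of the configuration $\{u_i(x)+\Delta_0(x-e_i,x)\}_{x,i}$; $\pi_0$ is the case $u=0$. An extreme point of $\mathcal{I}$ is $\pi\in\mathcal{I}$ such that $\pi=b\mu+(1-b)\nu$ with $0<b<1$, $\mu,\nu\in\mathcal{I}$ forces $\mu=\nu=\pi$. *)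

(* Defs.v *)
From HB Require Import structures.
From mathcomp Require Import all_boot all_order all_algebra.
From mathcomp Require Import all_classical all_reals all_analysis.
From mathcomp Require Import probability.
Set Implicit Arguments. Unset Strict Implicit. Unset Printing Implicit Defensive.
Import Order.TTheory GRing.Theory Num.Theory.
Import numFieldNormedType.Exports.
Local Open Scope classical_set_scope.
Local Open Scope ring_scope.

Section Defs.
Variables (R : realType) (d : nat).

Definition site := 'rV[int]_d.
Definition unit_e (i : 'I_d) : site := delta_mx 0 i.

Definition boxsum (M : nat) (f : site -> R) : R :=
  \sum_(k : {ffun 'I_d -> 'I_(M.*2).+1}) f (\row_j ((k j)%:Z - M%:Z)).

(* Configurations: eta x i stands for eta(x - e_i, x). *)
Definition conf := site -> 'I_d -> R.

Definition coord_sets : set (set conf) :=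
  [set S | exists (x : site) (i : 'I_d) (A : set R),
      measurable A /\ S = (fun eta : conf => eta x i) @^-1` A].
Definition confT := g_sigma_algebraType coord_sets.

Definition eta_coord (x : site) (i : 'I_d) : confT -> R := fun eta => eta x i.

Variables (M : nat) (p : site -> R).

Definition is_kernel : Prop :=
  [/\ (forall x, 0 <= p x /\ p x < 1),
      (forall x : site, (exists j, (M%:Z < `|x 0 j|)%R) -> p x = 0)
    & boxsum M p = 1].

Definition strongly_aperiodic : Prop :=
  forall (u y : site), exists s : seq (int * site),
    all (fun c => 0 < p c.2) s /\ y = \sum_(c <- s) (u + c.2) *~ c.1.

(* k-chain_step transition p^k(x,z), with p(x,y) = p(y-x). *)
Fixpoint pk (k : nat) (x z : site) : R :=
  match k with
  | 0%N => (x == z)%:R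
  | k'.+1 => boxsum M (fun w => p w * pk k' (x + w) z)
  end.

Definition p_harmonic (v : site -> R) : Prop :=
  forall x, boxsum M (fun w => p w * v (x + w)) = v x.

Definition chain_step (eta : conf) (xi : site -> R) : conf :=
  fun x i => boxsum M (fun w => p w * eta (x + w) i) + xi x - xi (x - unit_e i).

Section Noise.
Variables (dO : measure_display) (Omega : measurableType dO)
  (P : probability Omega R) (xi : int -> site -> Omega -> R).

Definition mutually_independent {I : eqType} (X : I -> Omega -> R) : Prop :=
  forall (s : seq I) (A : I -> set R), uniq s -> (forall i, measurable (A i)) ->
    P (\bigcap_(i in [set` s]) (X i @^-1` A i)) =
    (\prod_(i <- s) P (X i @^-1` A i))%E.

Definition iid_noise : Prop :=
  [/\ (forall t x, measurable_fun setT (xi t x)),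
      mutually_independent (fun tx : int * site => xi tx.1 tx.2),
      (forall t x t' x' (A : set R), measurable A ->
          P (xi t x @^-1` A) = P (xi t' x' @^-1` A)),
      (forall t x, P.-integrable setT (EFin \o xi t x) /\
                   P.-integrable setT (fun w => (xi t x w ^+ 2)%:E))
    & (forall t x, expectation P (xi t x) = 0%E)].

Definition chain_invariant (nu : probability confT R) : Prop :=
  forall B : set confT, measurable B ->
    nu B = (\int[nu]_eta P [set w | B (chain_step eta (fun x => xi 1%Z x w))])%E.

Definition extreme_invariant (nu : probability confT R) : Prop :=
  chain_invariant nu /\
  forall (b : R) (mu1 mu2 : probability confT R), 0 < b < 1 ->
    chain_invariant mu1 -> chain_invariant mu2 ->
    (forall B, measurable B -> nu B = (b%:E * mu1 B + (1 - b)%:E * mu2 B)%E) ->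
    forall B, measurable B -> mu1 B = nu B /\ mu2 B = nu B.

(* Delta_0(x - e_i, x) = sum_{k>=0} sum_z xi_{-k}(z) (p^k(x,z) - p^k(x-e_i,z));
   for fixed k the z-sum is over x + [-(kM+1), kM+1]^d which contains both supports. *)
Definition Delta0_term (x : site) (i : 'I_d) (w : Omega) (k : nat) : R :=
  boxsum (k * M + 1) (fun v =>
    xi (- k%:Z) (x + v) w * (pk k x (x + v) - pk k (x - unit_e i) (x + v))).

Definition Delta0 (x : site) (i : 'I_d) (w : Omega) : R :=
  lim ((fun n => \sum_(0 <= k < n) Delta0_term x i w k) @ \oo).

Definition Xconf (u : 'I_d -> site -> R) (w : Omega) : confT :=
  fun x i => u i x + Delta0 x i w.

Definition is_law (nu : probability confT R) (X : Omega -> confT) : Prop :=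
  forall B : set confT, measurable B -> nu B = P (X @^-1` B).

End Noise.
End Defs.

(* Main.v *)
(* Iterating the dynamics T times from a configuration eta of law nu in I gives
   P^T eta + D_T, where P is averaging against p and D_T, the partial sum of Delta_0
   over k < T, is independent of eta; so nu is the law of P^T eta + D_T for every T.
   Whenever P^T eta converges in nu-probability to a deterministic m, the measure nu is
   therefore the law of m + Delta_0.
   - If nu <= pi_u / b, this applies with m = u: under pi_u, P^T eta - u = P^T Delta_0 has
     the law of Delta_0 - D_T, which tends to 0. Hence pi_u is extreme.
   - By independence Var^nu eta = E^nu (P^T eta - m)^2 + Var D_T with m = E^nu eta harmonic,
     and Var D_T increases to the variance under pi_0. Equality forces P^T eta -> m.
   The sum of the variances of the terms of Delta_0 is finite because, for the noise at
   time 0 and a site x, sum_v p(v) E (P^k xi(x+v) - P^(k+1) xi(x))^2 equals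
   E (P^k xi(0))^2 - E (P^(k+1) xi(0))^2, which telescopes in k; strong aperiodicity passes
   from the differences of points of the support of p to the unit vectors. Almost sure
   convergence then follows from Kolmogorov's maximal inequality. *)

Require Import Defs.
From HB Require Import structures.
From mathcomp Require Import all_boot all_order all_algebra.
From mathcomp Require Import all_classical all_reals all_analysis.
From mathcomp Require Import probability measurable_realfun.
From mathcomp Require Import ring lra zify.
Set Implicit Arguments. Unset Strict Implicit. Unset Printing Implicit Defensive.
Import Order.TTheory GRing.Theory Num.Theory.
Import numFieldNormedType.Exports.
Local Open Scope classical_set_scope.
Local Open Scope ring_scope.

(** * Averaging operator and the series Delta_0 *)

Section Averaging.
Context {R : realType} {d : nat} (M : nat) (p : site d -> R).
Implicit Types (h : site d -> R) (x y : site d) (i : 'I_d) (g : int -> site d -> R).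

Definition avg h x : R := boxsum M (fun w => p w * h (x + w)).
Definition avgn k h := iter k avg h.

(** The k-th term of the series for Delta_0 along one realization [g] of the noise. The kernel p^k
    becomes k applications of the averaging operator, which composes well with time shifts. *)
Definition harness_term g k x i : R :=
  avgn k (g (- k%:Z)) x - avgn k (g (- k%:Z)) (x - unit_e i).
Definition harness_sum n g x i : R := \sum_(0 <= k < n) harness_term g k x i.
Definition harness_lim g x i : R := limn (fun n => harness_sum n g x i).
(** Moves time -s of [g] to time 0, so that the tail of a series in [g] becomes a series in the
    shifted field. *)
Definition tshift (s : nat) g : int -> site d -> R := fun t => g (t - s%:Z).

Lemma avgD h1 h2 x : avg (fun y => h1 y + h2 y) x = avg h1 x + avg h2 x.
Proof. by rewrite /avg /boxsum -big_split; apply: eq_bigr => k _; rewrite mulrDr. Qed.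

Lemma avgB h1 h2 x : avg (fun y => h1 y - h2 y) x = avg h1 x - avg h2 x.
Proof. by rewrite /avg /boxsum -sumrB; apply: eq_bigr => k _; rewrite mulrBr. Qed.

Lemma avg_sum n (F : nat -> site d -> R) x :
  avg (fun y => \sum_(0 <= k < n) F k y) x = \sum_(0 <= k < n) avg (F k) x.
Proof.
by rewrite /avg /boxsum exchange_big; apply: eq_bigr => k _; rewrite mulr_sumr.
Qed.

Lemma avg_shift h y x : avg (fun z => h (z - y)) x = avg h (x - y).
Proof. by apply: eq_bigr => k _; rewrite addrAC. Qed.

Lemma avgnS k h : avgn k.+1 h = avg (avgn k h).
Proof. by []. Qed.

Lemma avgnD k h1 h2 x : avgn k (fun y => h1 y + h2 y) x = avgn k h1 x + avgn k h2 x.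
Proof.
elim: k x => // k IH x; rewrite !avgnS -avgD.
by congr (avg _ x); apply/funext => y.
Qed.

Lemma avgnB k h1 h2 x : avgn k (fun y => h1 y - h2 y) x = avgn k h1 x - avgn k h2 x.
Proof.
elim: k x => // k IH x; rewrite !avgnS -avgB.
by congr (avg _ x); apply/funext => y.
Qed.

Lemma avgn_shift k h y x : avgn k (fun z => h (z - y)) x = avgn k h (x - y).
Proof.
elim: k x => // k IH x; rewrite !avgnS -avg_shift.
by congr (avg _ x); apply/funext => z.
Qed.

Lemma avgn_harmonic k h : p_harmonic M p h -> avgn k h = h.
Proof. by move=> hh; elim: k => // k IH; rewrite avgnS IH; apply/funext. Qed.

(** Distinct box indices give distinct points, so the indicator keeps exactly one summand, whose
    index has the coordinates y_j - x0_j + N. *)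
Lemma box_single N (x0 y : site d) (F : site d -> R) :
  (forall j, `|y 0 j - x0 0 j|%R <= N%:Z) ->
  boxsum N (fun v => F (x0 + v) * (y == x0 + v)%:R) = F y.
Proof.
move=> yN.
pose c j : int := y 0 j - x0 0 j + N%:Z.
have c0 j : 0 <= c j.
  have := yN j; rewrite ler_norml /c => /andP[]; move: (y 0 j) (x0 0 j) => a b; lia.
have cN j : (absz (c j) < N.*2.+1)%N.
  have := c0 j; have := yN j; rewrite ler_norml /c => /andP[]; move: (y 0 j) (x0 0 j) => a b; lia.
pose k0 : {ffun 'I_d -> 'I_(N.*2).+1} := [ffun j => inord (absz (c j))].
have k0E : x0 + \row_j ((k0 j)%:Z - N%:Z) = y.
  apply/rowP => j; rewrite !mxE ffunE inordK// gez0_abs// /c; ring.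
rewrite /boxsum (bigD1 k0)//= k0E eqxx mulr1 big1 ?addr0// => k kk0.
case: eqP => [yE|]; last by rewrite mulr0.
case/eqP: kk0; apply/ffunP => j; apply/val_inj.
move: yE; rewrite -k0E => /addrI /rowP /(_ j); rewrite !mxE => /addIr [] e.
by rewrite /= e.
Qed.

(** Induction on [k]: each step of the walk changes every coordinate by at most [M], so a box with
    room [k * M] around [y] contains all endpoints of the walk. *)
Lemma avgn_pk k N (x0 y : site d) h :
  (forall j, `|y 0 j - x0 0 j| + (k * M)%:Z <= N%:Z) ->
  boxsum N (fun v => h (x0 + v) * pk M p k y (x0 + v)) = avgn k h y.
Proof.
elim: k y => [|k IH] y yN.
  by apply: box_single => j; have := yN j; lia.
rewrite avgnS /avg /boxsum /=; under eq_bigr do rewrite mulr_sumr.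
rewrite exchange_big; apply: eq_bigr => w _ /=.
rewrite -IH /boxsum; first by rewrite mulr_sumr; apply: eq_bigr => v _; rewrite mulrCA.
move=> j; rewrite !mxE.
have := yN j; have := ltn_ord (w j); rewrite mulSn.
by move: (y 0 j) (x0 0 j) (k * M)%N (nat_of_ord (w j)) => a b c e; lia.
Qed.

Lemma sub_unit_le (x : site d) i j N : (0 < N)%N ->
  `|(x - unit_e i) 0 j - x 0 j| <= N%:Z.
Proof.
move=> N0; rewrite !mxE addrAC subrr sub0r normrN.
by case: (_ && _); rewrite ?normr1 ?normr0; lia.
Qed.

Lemma harness_termE dO (Omega : measurableType dO) (xi : int -> site d -> Omega -> R) x i w k :
  Delta0_term M p xi x i w k = harness_term (fun t z => xi t z w) k x i.
Proof.
(* The point [x - unit_e i] is at distance at most 1 from [x]; the extra 1 in the radius covers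
   it. *)
rewrite /harness_term -!(@avgn_pk _ (k * M + 1) x); last 2 first.
- by move=> j; rewrite PoszD addrC lerD2l sub_unit_le.
- by move=> j; rewrite subrr normr0 add0r lez_nat leq_addr.
by rewrite /Delta0_term /boxsum -sumrB; apply: eq_bigr => v _; rewrite mulrBr.
Qed.

Lemma Delta0E dO (Omega : measurableType dO) (xi : int -> site d -> Omega -> R) x i w :
  Delta0 M p xi x i w = harness_lim (fun t z => xi t z w) x i.
Proof.
rewrite /Delta0 /harness_lim; congr (limn _); apply/funext => n.
by apply: eq_bigr => k _; rewrite harness_termE.
Qed.

Lemma harness_term_grad g k x i :
  harness_term g k x i = avgn k (fun z => g (- k%:Z) z - g (- k%:Z) (z - unit_e i)) x.
Proof. by rewrite avgnB (avgn_shift k _ (unit_e i)). Qed.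

Lemma harness_term_shift T g k x i :
  harness_term g (T + k) x i = avgn T ((harness_term (tshift T g) k)^~ i) x.
Proof.
rewrite harness_term_grad /avgn iterD; congr (iter _ _ _ x).
apply/funext => y; rewrite harness_term_grad /tshift.
by rewrite (_ : - k%:Z - T%:Z = - (T + k)%N%:Z)//; lia.
Qed.

(** Splitting off the term k = 0, which carries the newest noise, exhibits the partial sum as one
    step of the chain applied to the partial sum of the older noise. *)
Lemma harness_sumS n g x i :
  harness_sum n.+1 g x i =
  avg ((harness_sum n (tshift 1 g))^~ i) x + g 0 x - g 0 (x - unit_e i).
Proof.
rewrite /harness_sum big_nat_recl// avg_sum -[RHS]addrA [RHS]addrC; congr (_ + _).
apply: eq_bigr => k _; exact: (harness_term_shift 1).
Qed.

Lemma avgn_sum T n (F : nat -> site d -> R) x :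
  avgn T (fun y => \sum_(0 <= k < n) F k y) x = \sum_(0 <= k < n) avgn T (F k) x.
Proof.
elim: T x => // T IH x; rewrite avgnS -(avg_sum n (fun k => avgn T (F k))).
by congr (avg _ x); apply/funext => y; rewrite IH.
Qed.

(** The last [n] terms carry at least [T] averagings each; factoring these out leaves the partial
    sum of the noise seen from time -T. *)
Lemma harness_sum_shift T n g x i :
  harness_sum (T + n) g x i =
  harness_sum T g x i + avgn T ((harness_sum n (tshift T g))^~ i) x.
Proof.
rewrite /harness_sum (@big_cat_nat _ _ _ T)//= ?leq_addr//; congr (_ + _).
rewrite avgn_sum -{1}(add0n T) big_addn addKn.
by apply: eq_bigr => k _; rewrite addnC harness_term_shift.
Qed.

(** By linearity the initial configuration is averaged once more, and by [harness_sumS] the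
    innovation [g 0] extends the partial sum by one term. *)
Lemma chain_harness T (eta : conf R d) g :
  chain_step M p (fun x i => avgn T (eta^~ i) x + harness_sum T (tshift 1 g) x i) (g 0)
  = (fun x i => avgn T.+1 (eta^~ i) x + harness_sum T.+1 g x i).
Proof.
apply/funext => x; apply/funext => i; rewrite harness_sumS /chain_step avgnS.
by rewrite -/(avg (fun y => avgn T (eta^~ i) y + harness_sum T (tshift 1 g) y i) x) avgD !addrA.
Qed.

Lemma cvg_avgn T (u : nat -> site d -> R) h x :
  (forall y, u^~ y @ \oo --> h y) -> (fun n => avgn T (u n) x) @ \oo --> avgn T h x.
Proof.
elim: T x => [|T IH] x uh; first exact: uh.
rewrite avgnS /avg /boxsum; apply: cvg_big => [|k _]; first exact: add_continuous.
by apply: cvgM; [exact: cvg_cst|exact: IH].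
Qed.

Definition harness_cvg g := forall x i, cvgn (fun n => harness_sum n g x i).

(** Lets [n] tend to infinity in [harness_sum_shift]; an average is a finite sum and so commutes
    with pointwise limits. *)
Lemma harness_lim_shift T g : harness_cvg (tshift T g) ->
  (forall x i, (fun n => harness_sum n g x i) @ \oo -->
    harness_sum T g x i + avgn T ((harness_lim (tshift T g))^~ i) x).
Proof.
move=> cg x i; rewrite -(cvg_shiftn T).
under eq_fun do rewrite addnC harness_sum_shift.
apply: cvgD; first exact: cvg_cst.
by apply: (@cvg_avgn T (fun n y => harness_sum n (tshift T g) y i)) => y; exact: cg.
Qed.

Lemma harness_limE T g x i : harness_cvg (tshift T g) ->
  harness_lim g x i = harness_sum T g x i + avgn T ((harness_lim (tshift T g))^~ i) x.
Proof. by move=> cg; apply/cvg_lim => //; exact: harness_lim_shift. Qed.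

End Averaging.

(** * Laws, moments and limits *)

Section Orthants.
Context {R : realType}.

(** Finite intersections of events X_j > a. With lists of constraints, intersection is
    concatenation, so stability under intersection is immediate. *)
Definition orthant {T J : Type} (X : J -> T -> R) (l : seq (J * R)) : set T :=
  [set t | all (fun c => c.2 < X c.1 t) l].

Definition coord_gen {T J : Type} (X : J -> T -> R) : set (set T) :=
  [set S | exists j (A : set R), measurable A /\ S = X j @^-1` A].

Lemma orthant_cat {T J : Type} (X : J -> T -> R) l1 l2 :
  orthant X (l1 ++ l2) = orthant X l1 `&` orthant X l2.
Proof.
by apply/seteqP; split => t; rewrite /orthant /= all_cat => /andP.
Qed.

Lemma measurable_orthant {J : Type} d (T : measurableType d) (X : J -> T -> R) l :
  (forall j, measurable_fun setT (X j)) -> measurable (orthant X l).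
Proof.
move=> mX; elim: l => [|[j a] l IH].
  by rewrite (_ : orthant X [::] = setT)//; apply/seteqP; split.
rewrite -cat1s orthant_cat; apply: measurableI => //.
rewrite (_ : orthant X _ = setT `&` X j @^-1` `]a, +oo[%classic); first exact: mX.
by apply/seteqP; split => t; rewrite /orthant /= in_itv/= !andbT // => -[].
Qed.

Lemma orthant_generates {T : pointedType} {J : Type} (X : J -> T -> R) :
  <<s coord_gen X >> = <<s range (orthant X) >>.
Proof.
apply/seteqP; split.
  apply: smallest_sub; first exact: smallest_sigma_algebra.
  move=> _ [j [A [mA ->]]].
  have mXj : measurable_fun setT (X j : g_sigma_algebraType (range (orthant X)) -> R).
    apply: (measurability _ (RGenOInfty.measurableE R)) => _ [_ [a ->] <-].
    rewrite setTI; apply: sub_sigma_algebra; exists [:: (j, a)] => //.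
  by have := mXj measurableT A mA; rewrite setTI.
apply: smallest_sub; first exact: smallest_sigma_algebra.
move=> _ [l _ <-].
apply: (@measurable_orthant J _ (g_sigma_algebraType (coord_gen X))) => j _ A mA.
by rewrite setTI; apply: sub_sigma_algebra; exists j, A.
Qed.

(** Orthants are stable under intersection, include the whole space and generate the sigma-algebra,
    so they determine a probability measure. *)
Lemma orthant_unique d (T : measurableType d) (J : Type) (X : J -> T -> R)
    (m1 m2 : probability T R) :
  @measurable d T = <<s coord_gen X >> ->
  (forall l, m1 (orthant X l) = m2 (orthant X l)) ->
  forall A, measurable A -> m1 A = m2 A.
Proof.
move=> mT m12; apply: (measure_unique (range (orthant X)) (fun=> setT)).
- by rewrite mT orthant_generates.
- by move=> _ _ [l1 _ <-] [l2 _ <-]; exists (l1 ++ l2); rewrite ?orthant_cat.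
- by move=> _; exists [::] => //; apply/seteqP; split.
- by apply/seteqP; split => // t _; exists 0%N.
- by move=> _ [l _ <-]; exact: m12.
- move=> k; rewrite (_ : _ setT = 1%E) ?ltry//; exact: probability_setT.
Qed.

Lemma measurable_coord d d' (T : measurableType d) (T' : measurableType d') (J : Type)
    (X : J -> T -> R) (f : T' -> T) :
  @measurable d T = <<s coord_gen X >> ->
  (forall j, measurable_fun setT (X j \o f)) -> measurable_fun setT f.
Proof.
move=> mT mf; apply: (measurability _ mT) => _ [_ [j [A [mA ->]]] <-].
exact: mf.
Qed.

Lemma coord_measurable d (T : measurableType d) (J : Type) (X : J -> T -> R) :
  measurable = <<s coord_gen X >> -> forall j, measurable_fun setT (X j).
Proof.
move=> mT j _ A mA; rewrite setTI mT; apply: sub_sigma_algebra.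
by exists j, A.
Qed.

End Orthants.

(** * Relabelling and gluing of i.i.d. families *)

Section Gluing.
Context {R : realType} dO (Omega : measurableType dO) (P : probability Omega R).
Context {J : eqType} (X : J -> Omega -> R).
Hypotheses (mX : forall j, measurable_fun setT (X j))
  (indX : mutually_independent P X)
  (idX : forall j k (A : set R), measurable A -> P (X j @^-1` A) = P (X k @^-1` A)).
Implicit Types (l : seq (J * R)) (c : pred J) (s t : J -> J).

(** A list may constrain one index several times. Gathering all constraints on [j] turns an orthant
    into an intersection with one event per index, to which independence applies. *)
Let ray l j : set R := [set r | all (fun a => (a.1 == j) ==> (a.2 < r)) l].

Let measurable_ray l j : measurable (ray l j).
Proof.
elim: l => [|[k a] l IH].
  by rewrite (_ : ray [::] j = setT)//; apply/seteqP; split.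
rewrite (_ : ray ((k, a) :: l) j =
  (if k == j then `]a, +oo[%classic else setT) `&` ray l j).
  by apply: measurableI => //; case: ifP.
apply/seteqP; split => r; rewrite /ray /=; case: eqP => //= _.
- by rewrite in_itv/= andbT => /andP.
- by rewrite in_itv/= andbT => -[-> ->].
- by case.
Qed.

Let orthant_prob s l : injective s ->
  P (orthant (X \o s) l) =
  (\prod_(j <- undup [seq a.1 | a <- l]) P (X j @^-1` ray l j))%E.
Proof.
move=> s_inj.
pose A k : set R := [set r | all (fun a => (s a.1 == k) ==> (a.2 < r)) l].
have AE k : A k = ray [seq (s a.1, a.2) | a <- l] k.
  by apply/seteqP; split => r; rewrite /A /ray /= all_map.
have AsE j : A (s j) = ray l j.
  rewrite /A /ray; apply/funext => r; congr is_true.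
  by apply: eq_all => a /=; rewrite (inj_eq s_inj).
have -> : orthant (X \o s) l =
    \bigcap_(k in [set` [seq s j | j <- undup [seq a.1 | a <- l]]]) (X k @^-1` A k).
  apply/seteqP; split => w; rewrite /orthant /=.
    move=> /allP wl k _; apply/allP => a al; apply/implyP => /eqP <-; exact: wl.
  move=> wl; apply/allP => a al.
  have := wl (s a.1); rewrite /A /= => /(_ _)/allP H.
  have /H : s a.1 \in [seq s j | j <- undup [seq a.1 | a <- l]].
    by apply/map_f; rewrite mem_undup; apply/map_f.
  by move/(_ _ al); rewrite eqxx.
rewrite indX; last 2 first.
- by rewrite map_inj_uniq// undup_uniq.
- by move=> k; rewrite AE.
rewrite big_map; apply: eq_bigr => j _; rewrite AsE; exact: idX.
Qed.

Let orthant_prob1 l : P (orthant X l) =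
  (\prod_(j <- undup [seq a.1 | a <- l]) P (X j @^-1` ray l j))%E.
Proof. exact: (@orthant_prob id l (@inj_id _)). Qed.

Lemma reindex_orthant s l : injective s -> P (orthant (X \o s) l) = P (orthant X l).
Proof. by move=> s_inj; rewrite orthant_prob// orthant_prob1. Qed.

(** The glued orthant is a rectangle: constraints on indices in [c] concern only the first sample,
    the others only the second. Each side factors over its indices by independence, and the two
    products recombine into the product for [X]. *)
Lemma glue_orthant c s t l : injective s -> injective t ->
  (P \x P)%E (orthant (fun j (w : Omega * Omega) =>
     if c j then X (s j) w.1 else X (t j) w.2) l) = P (orthant X l).
Proof.
move=> s_inj t_inj.
have -> : orthant (fun j (w : Omega * Omega) =>
     if c j then X (s j) w.1 else X (t j) w.2) l =
   orthant (X \o s) [seq a <- l | c a.1] `*` orthant (X \o t) [seq a <- l | ~~ c a.1].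
  apply/seteqP; split => -[w1 w2]; rewrite /orthant /= !all_filter.
    move/allP => wl; split; apply/allP => a /wl /=; rewrite /=;
    by case: (c a.1).
  case=> /allP w1l /allP w2l; apply/allP => a al.
  by have := w1l _ al; have := w2l _ al; rewrite /=; case: (c a.1).
rewrite product_measure1E; last 2 first.
- by apply: measurable_orthant => j; exact: mX.
- by apply: measurable_orthant => j; exact: mX.
transitivity (P (orthant (X \o s) [seq a <- l | c a.1]) *
  P (orthant (X \o t) [seq a <- l | ~~ c a.1]))%E; first by [].
rewrite orthant_prob1 (@orthant_prob s)// (@orthant_prob t)//.
have flt (q : pred J) : [seq a.1 | a <- l & q a.1] = [seq j <- [seq a.1 | a <- l] | q j].
  by rewrite filter_map.
rewrite [RHS](bigID c)/=; congr (_ * _)%E.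
all: rewrite ?(flt c) ?(flt (predC c)) -filter_undup big_filter; apply: eq_bigr => j cj.
all: congr (P (_ @^-1` _)); apply/funext => r; rewrite /ray; congr is_true.
all: rewrite all_filter; apply: eq_all => a /=; case: eqP => [->|_] /=.
all: by move: cj => /= cj; rewrite ?cj ?implybT.
Qed.

End Gluing.

(** * Transfer of integrals between random elements of the same law *)

Section Laws.
Context {R : realType}.

Definition image_law d d' (T : measurableType d) (T' : measurableType d')
    (P : probability T R) (U : T -> T') (mU : measurable_fun setT U) : probability T' R :=
  distribution P (mfun_Sub (mem_set mU)).

Definition same_law d1 d2 d (T1 : measurableType d1) (T2 : measurableType d2)
    (T : measurableType d) (P1 : probability T1 R) (U1 : T1 -> T)
    (P2 : probability T2 R) (U2 : T2 -> T) : Prop :=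
  forall A, measurable A -> P1 (U1 @^-1` A) = P2 (U2 @^-1` A).

Lemma same_law_orthant d1 d2 d (T1 : measurableType d1) (T2 : measurableType d2)
    (T : measurableType d) (P1 : probability T1 R) (U1 : T1 -> T)
    (P2 : probability T2 R) (U2 : T2 -> T) (J : Type) (X : J -> T -> R) :
  measurable_fun setT U1 -> measurable_fun setT U2 ->
  @measurable d T = <<s coord_gen X >> ->
  (forall l, P1 (orthant (fun j t => X j (U1 t)) l) = P2 (orthant (fun j t => X j (U2 t)) l)) ->
  same_law P1 U1 P2 U2.
Proof.
move=> mU1 mU2 mT H A mA.
exact: (@orthant_unique _ _ _ _ _ (image_law P1 mU1) (image_law P2 mU2) mT).
Qed.

Section Transfer.
Context d1 d2 d (T1 : measurableType d1) (T2 : measurableType d2)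
    (T : measurableType d) (P1 : probability T1 R) (U1 : T1 -> T)
    (P2 : probability T2 R) (U2 : T2 -> T).
Hypotheses (mU1 : measurable_fun setT U1) (mU2 : measurable_fun setT U2)
  (U12 : same_law P1 U1 P2 U2).
Local Open Scope ereal_scope.

Lemma same_law_ge0_integral (F : T -> \bar R) :
  measurable_fun setT F -> (forall t, 0 <= F t) ->
  \int[P1]_x F (U1 x) = \int[P2]_x F (U2 x).
Proof.
move=> mF F0.
rewrite -[LHS](@ge0_integral_pushforward _ _ _ _ _ _ mU1 _ setT)//.
rewrite -[RHS](@ge0_integral_pushforward _ _ _ _ _ _ mU2 _ setT)//.
apply: (@eq_measure_integral _ _ _ _ (image_law P2 mU2) (image_law P1 mU1)).
by move=> A mA _; exact: U12.
Qed.

Lemma same_law_integrable (F : T -> \bar R) : measurable_fun setT F ->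
  P1.-integrable setT (F \o U1) -> P2.-integrable setT (F \o U2).
Proof.
move=> mF /integrableP[_ i1]; apply/integrableP; split; first exact: measurableT_comp.
rewrite -(@same_law_ge0_integral (fun t => `|F t|))//.
exact: measurableT_comp.
Qed.

Lemma same_law_integral (F : T -> \bar R) : measurable_fun setT F ->
  P1.-integrable setT (F \o U1) ->
  \int[P1]_x F (U1 x) = \int[P2]_x F (U2 x).
Proof.
move=> mF i1; have i2 := same_law_integrable mF i1.
rewrite -[LHS](@integral_pushforward _ _ _ _ _ _ mU1 _ setT)//.
rewrite -[RHS](@integral_pushforward _ _ _ _ _ _ mU2 _ setT)//.
apply: (@eq_measure_integral _ _ _ _ (image_law P2 mU2) (image_law P1 mU1)).
by move=> A mA _; exact: U12.
Qed.

End Transfer.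
End Laws.

(** * First and second moments *)

Section Moments.
Context {R : realType} d (T : measurableType d) (P : probability T R).
Implicit Types f g : T -> R.

Definition mean f : R := fine (\int[P]_w (f w)%:E)%E.

Lemma Lfun2P f : f \in Lfun P 2%:E <->
  measurable_fun setT f /\ P.-integrable setT (fun w => (f w ^+ 2)%:E).
Proof.
split=> [f2|[mf /integrableP[_ if2]]].
  split; last exact: Lfun2_integrable_sqr.
  by move: f2; rewrite inE => /andP[]; rewrite inE.
rewrite inE; apply/andP; split; rewrite inE//=.
rewrite /finite_norm unlock /=.
apply: poweR_lty; apply: le_lt_trans if2; apply: ge0_le_integral => //.
- apply/measurable_EFinP.
  by apply/(@measurableT_comp _ _ _ _ _ _ (fun x : R => x `^ 2)%R) => //; exact/measurableT_comp.
- by apply/measurable_EFinP/measurableT_comp => //; exact: measurable_funX.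
- by move=> t _ /=; rewrite lee_fin powR_mulrn// real_normK ?num_real// ler_norm.
Qed.

Lemma Lfun2_measurable f : f \in Lfun P 2%:E -> measurable_fun setT f.
Proof. by move/Lfun2P => []. Qed.

Lemma Lfun2_Lfun1 f : f \in Lfun P 2%:E -> f \in Lfun P 1.
Proof. by apply: Lfun_subset12; exact: fin_num_measure. Qed.

Lemma Lfun1_EFin f : f \in Lfun P 1 -> P.-integrable setT (fun w => (f w)%:E).
Proof. by move/Lfun1_integrable. Qed.

Lemma mean_EFin f : f \in Lfun P 1 -> (\int[P]_w (f w)%:E = (mean f)%:E)%E.
Proof. by move=> /Lfun1_EFin f1; rewrite fineK// integrable_fin_num. Qed.

Lemma mean_cst (c : R) : mean (fun=> c) = c.
Proof.
by rewrite /mean -[X in fine X]/(\int[P]_w cst c%:E w)%E integral_cst// [X in (_ * X)%E](probability_setT P) mule1.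
Qed.

Lemma meanD f g : f \in Lfun P 1 -> g \in Lfun P 1 ->
  mean (fun w => f w + g w) = mean f + mean g.
Proof.
move=> f1 g1; apply: EFin_inj; rewrite EFinD -!mean_EFin//; last exact: rpredD.
by rewrite -integralD_EFin//; exact: Lfun1_EFin.
Qed.

Lemma meanB f g : f \in Lfun P 1 -> g \in Lfun P 1 ->
  mean (fun w => f w - g w) = mean f - mean g.
Proof.
move=> f1 g1; apply: EFin_inj; rewrite EFinB -!mean_EFin//; last exact: rpredB.
by rewrite -integralB_EFin//; exact: Lfun1_EFin.
Qed.

Lemma Lfun1Z k f : f \in Lfun P 1 -> (fun w => k * f w) \in Lfun P 1.
Proof.
by move=> f1; rewrite (_ : (fun w => _) = k \o* f) ?Lfun_scale//; apply/funext => w /=; rewrite mulrC.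
Qed.

Lemma Lfun2Z k f : f \in Lfun P 2%:E -> (fun w => k * f w) \in Lfun P 2%:E.
Proof.
move=> f1; rewrite (_ : (fun w => _) = k \o* f) ?Lfun_scale ?ler1n//.
by apply/funext => w /=; rewrite mulrC.
Qed.

Lemma meanZ k f : f \in Lfun P 1 -> mean (fun w => k * f w) = k * mean f.
Proof.
move=> f1; apply: EFin_inj; rewrite EFinM -!mean_EFin//; last exact: Lfun1Z.
by under eq_integral do rewrite EFinM; rewrite integralZl//; exact: Lfun1_EFin.
Qed.

Lemma Lfun1_sum (I : Type) (s : seq I) (F : I -> T -> R) :
  (forall i, F i \in Lfun P 1) -> (fun w => \sum_(i <- s) F i w) \in Lfun P 1.
Proof.
move=> F1; rewrite (_ : (fun w => _) = \sum_(i <- s) F i); first exact: rpred_sum.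
by apply/funext => w; rewrite fct_sumE.
Qed.

Lemma mean_sum (I : Type) (s : seq I) (F : I -> T -> R) :
  (forall i, F i \in Lfun P 1) ->
  mean (fun w => \sum_(i <- s) F i w) = \sum_(i <- s) mean (F i).
Proof.
move=> F1; elim: s => [|a s IH].
  rewrite big_nil /mean; under eq_integral do rewrite big_nil.
  by rewrite integral0.
rewrite big_cons -IH -meanD//.
  by congr mean; apply/funext => w; rewrite big_cons.
exact: Lfun1_sum.
Qed.

Lemma Lfun2D f g : f \in Lfun P 2%:E -> g \in Lfun P 2%:E ->
  (fun w => f w + g w) \in Lfun P 2%:E.
Proof. by move=> f2 g2; apply: rpredD => //; rewrite ?lee1n. Qed.

Lemma Lfun2B f g : f \in Lfun P 2%:E -> g \in Lfun P 2%:E ->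
  (fun w => f w - g w) \in Lfun P 2%:E.
Proof. by move=> f2 g2; apply: rpredB; rewrite ?lee1n. Qed.

Lemma Lfun2_sum (I : Type) (s : seq I) (F : I -> T -> R) :
  (forall i, F i \in Lfun P 2%:E) -> (fun w => \sum_(i <- s) F i w) \in Lfun P 2%:E.
Proof.
move=> F2; elim: s => [|a s IH].
  by under eq_fun do rewrite big_nil; exact: Lfun_cst.
by under eq_fun do rewrite big_cons; exact: Lfun2D.
Qed.

Lemma Lfun2M f g : f \in Lfun P 2%:E -> g \in Lfun P 2%:E ->
  (fun w => f w * g w) \in Lfun P 1.
Proof. exact: Lfun2_mul_Lfun1. Qed.

Lemma Lfun2X f : f \in Lfun P 2%:E -> (fun w => f w ^+ 2) \in Lfun P 1.
Proof. by move=> f2; apply: Lfun2M. Qed.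

Lemma mean_le f g : f \in Lfun P 1 -> g \in Lfun P 1 ->
  (forall w, f w <= g w) -> mean f <= mean g.
Proof.
move=> f1 g1 fg; rewrite -lee_fin -!mean_EFin//.
apply: le_integral; [by []|exact: Lfun1_EFin|exact: Lfun1_EFin|].
by move=> w _; rewrite lee_fin.
Qed.

Lemma mean_ge0 f : (forall w, 0 <= f w) -> 0 <= mean f.
Proof. by move=> f0; rewrite fine_ge0// integral_ge0// => w _; rewrite lee_fin. Qed.

Lemma mean_sqrD f g : f \in Lfun P 2%:E -> g \in Lfun P 2%:E ->
  mean (fun w => f w * g w) = 0 ->
  mean (fun w => (f w + g w) ^+ 2) = mean (fun w => f w ^+ 2) + mean (fun w => g w ^+ 2).
Proof.
move=> f2 g2 fg.
under [in LHS]eq_fun do rewrite sqrrD -mulr_natl -addrA addrCA.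
rewrite (meanD (f := fun w => 2 * (f w * g w)) (g := fun w => f w ^+ 2 + g w ^+ 2)).
- by rewrite meanZ ?Lfun2M// fg mulr0 add0r meanD// Lfun2X.
- by apply: Lfun1Z; exact: Lfun2M.
- by apply: rpredD; exact: Lfun2X.
Qed.

Lemma mean_sqr_D_le f g : f \in Lfun P 2%:E -> g \in Lfun P 2%:E ->
  mean (fun w => (f w + g w) ^+ 2) <=
  2 * (mean (fun w => f w ^+ 2) + mean (fun w => g w ^+ 2)).
Proof.
move=> f2 g2; rewrite -meanD ?Lfun2X// -meanZ; last by apply: rpredD; exact: Lfun2X.
apply: mean_le; first by apply: Lfun2X; exact: Lfun2D.
  by apply: Lfun1Z; apply: rpredD; exact: Lfun2X.
by move=> w; have := sqr_ge0 (f w - g w); rewrite sqrrB sqrrD; lra.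
Qed.

Lemma chebyshev_bound f (e : R) : measurable_fun setT f -> 0 < e ->
  ((e ^+ 2)%:E * P [set w | (e <= `|f w|)%R] <= \int[P]_w (f w ^+ 2)%:E)%E.
Proof.
move=> mf e0.
have mA : measurable [set w | e <= `|f w|].
  rewrite -[X in measurable X]setTI.
  by apply: (measurable_fun_ler (D := setT)) => //; exact: measurableT_comp.
rewrite -(setTI [set w | _ <= _]) -integral_cst ?setTI//.
apply: (@le_trans _ _ (\int[P]_(w in [set w | (e <= `|f w|)%R]) (f w ^+ 2)%:E)%E).
  apply: ge0_le_integral => //.
  - by move=> w _; rewrite lee_fin sqr_ge0.
  - by apply/measurable_EFinP/measurable_funX; exact: measurable_funTS.
  - move=> w /= ew; rewrite lee_fin -[leRHS]real_normK ?num_real//.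
    by rewrite ler_sqr ?nnegrE// ltW.
apply: ge0_subset_integral => //.
  by apply/measurable_EFinP/measurable_funX.
by move=> w _; rewrite lee_fin sqr_ge0.
Qed.

End Moments.

(** * Measurability of limits of real sequences *)

Section SequenceLimits.
Context {R : realType}.

(** The Cauchy criterion with all quantifiers over the naturals, so that the set of convergence is
    built from countable unions and intersections. *)
Lemma cvgn_cauchyP (u : nat -> R) :
  cvgn u <-> forall k, exists N, forall j, `|u (N + j)%N - u N| < k.+1%:R^-1.
Proof.
split=> [cu k|Hu].
  have k0 : 0 < k.+1%:R^-1 / 2 :> R by rewrite divr_gt0.
  have /cvgrPdist_lt /(_ _ k0) [N _ HN] := cu.
  exists N => j; rewrite -(subrKA (limn u)) (le_lt_trans (ler_normD _ _))//.
  rewrite [ltRHS]splitr ltrD//; last by apply: HN => /=.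
  by rewrite distrC; apply: HN => /=; rewrite leq_addr.
apply/cauchy_cvgP; apply: cauchy_exP => e e0.
have [k] := ltr_add_invr e0; rewrite add0r => ke.
have [N HN] := Hu k; exists (u N); exists N => // n /= Nn.
by have := HN (n - N)%N; rewrite subnKC// /ball/= distrC => /lt_trans; apply.
Qed.

Lemma measurable_forall_count d (T : measurableType d) (J : countType) (Q : J -> set T) :
  (forall j, measurable (Q j)) -> measurable [set t | forall j, Q j t].
Proof.
move=> mQ; rewrite (_ : [set t | _] = \bigcap_n oapp Q setT (unpickle n)).
  by apply: bigcap_measurableType => n _; case: unpickle => [j|] /=; [exact: mQ|exact: measurableT].
apply/seteqP; split => [t Qt n _|t Qt j]; first by case: unpickle => /=.
by have := Qt (pickle j) Logic.I; rewrite pickleK.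
Qed.

Lemma measurable_cvgn d (T : measurableType d) (u : nat -> T -> R) :
  (forall n, measurable_fun setT (u n)) -> measurable [set t | cvgn (u^~ t)].
Proof.
move=> mu; rewrite (_ : [set t | _] = [set t | forall k,
    (\bigcup_N [set t | forall j, `|u (N + j)%N t - u N t| < k.+1%:R^-1]) t]).
  apply: measurable_forall_count => k; apply: bigcup_measurable => N _.
  apply: measurable_forall_count => j; rewrite -[X in measurable X]setTI.
  apply: (measurable_fun_ltr (D := setT)) => //.
  by apply: measurableT_comp => //; exact: measurable_funB.
apply/seteqP; split => t /=.
  by move/cvgn_cauchyP => H k; have [N HN] := H k; exists N.
by move=> H; apply/cvgn_cauchyP => k; have [N _ HN] := H k; exists N.
Qed.

Lemma measurable_limn d (T : measurableType d) (u : nat -> T -> R) :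
  (forall n, measurable_fun setT (u n)) -> measurable_fun setT (fun t => limn (u^~ t)).
Proof.
move=> mu; pose C := [set t | cvgn (u^~ t)].
have mC : measurable C := measurable_cvgn mu.
(* Off the set of convergence [limn] takes the default value [point]; replacing the sequence there
   by this constant keeps the limit and makes it converge everywhere. *)
pose v n t := if t \in C then u n t else point.
apply: (@measurable_fun_cvg _ _ _ setT v) => [n|t _].
  apply: measurable_fun_ifT => //.
  by apply: (measurable_fun_bool true); rewrite setTI preimage_mem_true.
rewrite /v; case: (boolP (t \in C)) => tC; first by rewrite inE in tC.
rewrite (_ : limn _ = point); first exact: cvg_cst.
by apply: dvgP; move: tC; rewrite notin_setE.
Qed.

End SequenceLimits.

(** * Limits in probability of families with constant law *)

Section OrthantLimits.
Context {R : realType} d (Z : measurableType d) (Q : probability Z R) {J : eqType}.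
Implicit Types (X Y : J -> Z -> R) (l : seq (J * R)) (e : R).
Local Open Scope ereal_scope.

Let shift e l : seq (J * R) := [seq (c.1, (c.2 + e)%R) | c <- l].

Let gap X Y e j : set Z := [set z | (e <= `|X j z - Y j z|)%R].

Let measurable_gap X Y e j : (forall j, measurable_fun setT (X j)) ->
  (forall j, measurable_fun setT (Y j)) -> measurable (gap X Y e j).
Proof.
move=> mX mY; rewrite -[X in measurable X]setTI.
apply: (measurable_fun_ler (D := setT)) => //.
by apply: measurableT_comp => //; exact: measurable_funB.
Qed.

(** If X_j > a + e while Y_j <= a, then |X_j - Y_j| >= e; a union bound over the constraints adds up
    these gaps. *)
Let orthant_gap X Y e l : (forall j, measurable_fun setT (X j)) ->
  (forall j, measurable_fun setT (Y j)) ->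
  Q (orthant X (shift e l)) <= Q (orthant Y l) + \sum_(c <- l) Q (gap X Y e c.1).
Proof.
move=> mX mY; pose G := \big[setU/set0]_(c <- l) gap X Y e c.1.
have mG : measurable G by apply: bigsetU_measurable => c _; exact: measurable_gap.
have QG : Q G <= \sum_(c <- l) Q (gap X Y e c.1).
  rewrite /G; elim: l {G mG} => [|c l IH]; first by rewrite !big_nil measure0.
  rewrite !big_cons; apply: le_trans (measureU2 _ _ _) _.
  - exact: measurable_gap.
  - by apply: bigsetU_measurable => c' _; exact: measurable_gap.
  - exact: leeD2l.
apply: le_trans (leeD2l _ QG); apply: le_trans (measureU2 _ _ mG).
  apply: le_measure; rewrite ?inE; first exact: measurable_orthant.
    by apply: measurableU => //; exact: measurable_orthant.
  move=> z; rewrite /orthant /shift /= all_map => Xz.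
  apply: contrapT => /not_orP[nY nG]; apply: nY; rewrite /G in nG.
  elim: l {G mG QG} Xz nG => //= -[j a] l IH /andP[/= az Xz]; rewrite big_cons.
  move=> /not_orP[/= ng nG]; rewrite IH// andbT /gap /=.
  move: ng; rewrite /gap /= => /negP; rewrite -ltNge ltr_norml => /andP[_].
  by move: az => /=; lra.
exact: measurable_orthant.
Qed.

(** As the inequalities are strict, the orthants with thresholds raised by 1/(n+1) increase to the
    original one; continuity from below concludes. *)
Let orthant_inner X l r : (forall j, measurable_fun setT (X j)) ->
  (forall e, (0 < e)%R -> Q (orthant X (shift e l)) <= r) -> Q (orthant X l) <= r.
Proof.
move=> mX Xr; pose F n := orthant X (shift (n.+1%:R^-1) l).
have mF n : measurable (F n) by exact: measurable_orthant.
have leF m n c z : (m <= n)%N -> (c.2 + m.+1%:R^-1 < X c.1 z -> c.2 + n.+1%:R^-1 < X c.1 z)%R.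
  move=> mn; apply: le_lt_trans; rewrite lerD2l lef_pV2 ?posrE//.
  by rewrite ler_nat.
have FE : \bigcup_n F n = orthant X l.
  apply/seteqP; split => z.
    move=> [n _]; rewrite /F /orthant /= all_map => Xz; apply/allP => c cl.
    have /= := allP Xz c cl.
    by apply: le_lt_trans; rewrite lerDl.
  rewrite /orthant /= => Xz.
  suff [n nz] : exists n, all (fun c => c.2 + n.+1%:R^-1 < X c.1 z)%R l.
    by exists n => //; rewrite /F /orthant /= all_map.
  elim: l {F mF Xr} Xz => [|c l' IH] /=; first by exists 0%N.
  move=> /andP[cz /IH[n /allP nz]]; have [k] := ltr_add_invr cz => ck.
  exists (maxn k n); rewrite (leF k)// ?leq_maxl//=.
  by apply/allP => c' /nz; apply: leF; rewrite leq_maxr.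
rewrite -FE.
have ndF : nondecreasing_seq F.
  move=> m n mn; apply/subsetPset => z; rewrite /F /orthant /= !all_map => Xz.
  by apply/allP => c cl; have /= := allP Xz c cl; exact: leF.
have cF := @nondecreasing_cvg_mu _ _ _ Q F mF (bigcup_measurable (fun n _ => mF n)) ndF.
rewrite -(cvg_lim _ cF)//; apply: lime_le; first exact: cvgP cF.
by apply: nearW => n; apply: Xr; rewrite invr_gt0.
Qed.

(** The orthant probabilities of [X n] do not depend on [n], so [n] may tend to infinity in
    [orthant_gap], used between [X n] and [Y] in either order. The gaps vanish, and [orthant_inner]
    removes the raise of the thresholds. *)
Lemma orthant_cvg_prob (X : nat -> J -> Z -> R) Y :
  (forall n j, measurable_fun setT (X n j)) -> (forall j, measurable_fun setT (Y j)) ->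
  (forall j e, (0 < e)%R -> Q [set z | (e <= `|X n j z - Y j z|)%R] @[n --> \oo] --> 0) ->
  (forall n l, Q (orthant (X n) l) = Q (orthant (X 0%N) l)) ->
  forall l, Q (orthant (X 0%N) l) = Q (orthant Y l).
Proof.
move=> mX mY XY X0 l.
have gap0 e : (0 < e)%R ->
    \sum_(c <- l) Q (gap (X n) Y e c.1) @[n --> \oo] --> 0.
  move=> e0; rewrite [X in _ --> X](_ : _ = \sum_(c <- l) 0); last by rewrite big1.
  apply: cvg_nnesum => c _; first by apply: nearW => n; exact: measure_ge0.
  exact: XY.
apply/eqP; rewrite eq_le; apply/andP; split; apply: orthant_inner => // e e0.
  have lim : Q (orthant Y l) + \sum_(c <- l) Q (gap (X n) Y e c.1) @[n --> \oo] -->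
      Q (orthant Y l) + 0.
    by apply: cvgeD; [exact: fin_num_adde_defl|exact: cvg_cst|exact: gap0].
  rewrite -[leRHS]adde0 -(cvg_lim _ lim)//; apply: lime_ge; first exact: cvgP lim.
  by apply: nearW => n; rewrite -(X0 n); exact: orthant_gap.
have lim : Q (orthant (X 0%N) l) + \sum_(c <- l) Q (gap (X n) Y e c.1) @[n --> \oo] -->
      Q (orthant (X 0%N) l) + 0.
  by apply: cvgeD; [exact: fin_num_adde_defl|exact: cvg_cst|exact: gap0].
rewrite -[leRHS]adde0 -(cvg_lim _ lim)//; apply: lime_ge; first exact: cvgP lim.
apply: nearW => n; rewrite -(X0 n); apply: le_trans (@orthant_gap Y (X n) e l mY (mX n)) _.
apply: leeD2l; rewrite (_ : \sum_(c <- l) _ = \sum_(c <- l) Q (gap (X n) Y e c.1))//.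
apply: eq_bigr => c _; congr (Q _); apply/seteqP; split => z;
  by rewrite /gap /= distrC.
Qed.

End OrthantLimits.

(** * The noise field and the increment chain *)

Section Spaces.
Context {R : realType} {d : nat}.

Definition field_coord (tx : int * site d) (g : int -> site d -> R) : R := g tx.1 tx.2.
(** Realizations of the noise are points of a product space, so that the law of the whole space-time
    field can be compared under shifts and gluing. *)
Definition fieldT := g_sigma_algebraType (coord_gen field_coord).
Definition conf_coord (xj : site d * 'I_d) (eta : conf R d) : R := eta xj.1 xj.2.

Lemma confT_gen : @measurable _ (confT R d) = <<s coord_gen conf_coord >>.
Proof.
rewrite /measurable /=; congr (<<s _ >>); apply/seteqP; split => S.
  by case=> x [i [A [mA ->]]]; exists (x, i), A.
by case=> -[x i] [A [mA ->]]; exists x, i, A.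
Qed.

Lemma measurable_field_coord t x : measurable_fun setT (fun g : fieldT => g t x).
Proof. exact: (@coord_measurable _ _ fieldT _ field_coord erefl (t, x)). Qed.

Lemma measurable_conf_coord x i : measurable_fun setT (fun eta : confT R d => eta x i).
Proof. exact: (coord_measurable confT_gen (x, i)). Qed.

Lemma measurable_field dT (T : measurableType dT) (f : T -> fieldT) :
  (forall t x, measurable_fun setT (fun w => f w t x)) -> measurable_fun setT f.
Proof.
move=> mf; apply: (@measurable_coord _ _ _ fieldT _ _ field_coord) => // -[t x].
exact: mf.
Qed.

Lemma measurable_conf dT (T : measurableType dT) (f : T -> confT R d) :
  (forall x i, measurable_fun setT (fun w => f w x i)) -> measurable_fun setT f.
Proof. by move=> mf; apply: (measurable_coord confT_gen) => -[x i]; exact: mf. Qed.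

Variables (M : nat) (p : site d -> R).

Lemma measurable_avgn dT (T : measurableType dT) k (F : T -> site d -> R) x :
  (forall y, measurable_fun setT (F^~ y)) ->
  measurable_fun setT (fun w => avgn M p k (F w) x).
Proof.
elim: k x => [|k IH] x mF; first exact: mF.
under eq_fun do rewrite avgnS /avg /boxsum.
apply: measurable_sum => v; apply: measurable_funM; first exact: measurable_cst.
exact: IH.
Qed.

Lemma measurable_harness_term k x i :
  measurable_fun setT (fun g : fieldT => harness_term M p g k x i).
Proof.
by apply: measurable_funB; apply: (measurable_avgn (T := fieldT)) => y;
  exact: measurable_field_coord.
Qed.

Lemma measurable_harness_sum n x i :
  measurable_fun setT (fun g : fieldT => harness_sum M p n g x i).
Proof. by apply: measurable_sum => k; exact: measurable_harness_term. Qed.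

Lemma Lfun2_avgn dT (T : measurableType dT) (Q : probability T R) k (F : T -> site d -> R) x :
  (forall y, F^~ y \in Lfun Q 2%:E) -> (fun w => avgn M p k (F w) x) \in Lfun Q 2%:E.
Proof.
elim: k x => [|k IH] x mF; first exact: mF.
by under eq_fun do rewrite avgnS /avg /boxsum; apply: Lfun2_sum => v; apply/Lfun2Z/IH.
Qed.

Lemma mean_avgn dT (T : measurableType dT) (Q : probability T R) k (F : T -> site d -> R) x :
  (forall y, F^~ y \in Lfun Q 2%:E) ->
  mean Q (fun w => avgn M p k (F w) x) = avgn M p k (fun y => mean Q (F^~ y)) x.
Proof.
elim: k x => [|k IH] x mF; first by [].
rewrite avgnS /avg /boxsum.
under [in LHS]eq_fun do rewrite avgnS /avg /boxsum.
rewrite mean_sum; last by move=> v; apply/Lfun1Z/Lfun2_Lfun1/Lfun2_avgn.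
by apply: eq_bigr => v _; rewrite meanZ ?IH//; apply/Lfun2_Lfun1/Lfun2_avgn.
Qed.

Lemma box_ge N (v : site d) (F : site d -> R) : (forall u, 0 <= F u) ->
  (forall j, `|v 0 j| <= N%:Z) -> F v <= boxsum N F.
Proof.
move=> F0 vN; rewrite -(@box_single _ _ N 0 v F); last by move=> j; rewrite mxE subr0.
apply: ler_sum => k _; rewrite add0r; case: eqP => _ /=; first by rewrite mulr1.
by rewrite mulr0.
Qed.

Lemma weighted_variance (a : site d -> R) : boxsum M p = 1 ->
  boxsum M (fun v => p v * (a v - boxsum M (fun v => p v * a v)) ^+ 2) =
  boxsum M (fun v => p v * a v ^+ 2) - boxsum M (fun v => p v * a v) ^+ 2.
Proof.
move=> p1.
have E m : boxsum M (fun v => p v * (a v - m) ^+ 2) =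
    boxsum M (fun v => p v * a v ^+ 2) - 2 * m * boxsum M (fun v => p v * a v)
    + m ^+ 2 * boxsum M p.
  rewrite /boxsum !mulr_sumr -sumrB -big_split /=.
  by apply: eq_bigr => v _; ring.
by rewrite E p1; ring.
Qed.

End Spaces.

(** * Law of the noise and independence of its blocks *)

Section Noise.
Context {R : realType} {d : nat} (M : nat) (p : site d -> R)
  dO (Omega : measurableType dO) (P : probability Omega R)
  (xi : int -> site d -> Omega -> R).
Hypotheses (Hp : is_kernel M p) (Hap : strongly_aperiodic p) (Hxi : iid_noise P xi).
Notation avgn := (avgn M p).
Notation harness_term := (harness_term M p).
Notation harness_sum := (harness_sum M p).
Implicit Types (x y v : site d).

Definition noise (w : Omega) : fieldT := fun t x => xi t x w.

Lemma measurable_noise : measurable_fun setT noise.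
Proof.
by apply: measurable_field => t x; case: Hxi => mxi _ _ _ _; exact: mxi.
Qed.

(** Injectivity keeps the relabelled variables distinct, so they are again independent with the same
    one-site law. Used for shifts in space and time. *)
Lemma noise_reindex (s : int * site d -> int * site d) : injective s ->
  same_law P (fun w => (fun t x => noise w (s (t, x)).1 (s (t, x)).2) : fieldT) P noise.
Proof.
case: Hxi => mxi ixi dxi _ _ s_inj.
apply: (@same_law_orthant _ _ _ _ _ _ fieldT _ _ _ _ _ field_coord) => //.
- by apply: measurable_field => t x; exact: mxi.
- exact: measurable_noise.
move=> l; rewrite -[RHS](reindex_orthant ixi _ l s_inj)//.
  by congr (P (orthant _ l)); apply/funext => -[t x].
by move=> [t x] [t' x'] A; exact: dxi.
Qed.

Definition glue (c : pred (int * site d)) (s r : int * site d -> int * site d)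
    (w : Omega * Omega) : fieldT :=
  fun t x => if c (t, x) then noise w.1 (s (t, x)).1 (s (t, x)).2
             else noise w.2 (r (t, x)).1 (r (t, x)).2.

Lemma measurable_glue c s r : measurable_fun setT (glue c s r).
Proof.
case: Hxi => mxi _ _ _ _; apply: measurable_field => t x; rewrite /glue.
by case: (c _); apply: (measurableT_comp (mxi _ _)) => //; exact: measurable_snd.
Qed.

(** Sites in [c] read one sample and the others an independent one; by injectivity of [s] and [r] no
    variable is used twice, so the glued field is again i.i.d. *)
Lemma noise_glue c s r : injective s -> injective r ->
  same_law (P \x P)%E (glue c s r) P noise.
Proof.
case: Hxi => mxi ixi dxi _ _ s_inj r_inj.
apply: (@same_law_orthant _ _ _ _ _ _ fieldT _ _ _ _ _ field_coord) => //.
- exact: measurable_glue.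
- exact: measurable_noise.
move=> l; rewrite -[RHS](glue_orthant (fun tx => mxi tx.1 tx.2) ixi _ c l s_inj r_inj)//.
  by congr ((P \x P)%E (orthant _ l)); apply/funext => -[t x].
by move=> [t x] [t' x'] A; exact: dxi.
Qed.

(* Gluing two independent copies of the noise along [c] does not change its law, so Fubini factorizes
   the expectation. *)
Lemma mean_block_orthogonal (c : pred (int * site d)) (f h : fieldT -> R) :
  measurable_fun setT f -> measurable_fun setT h ->
  f \o noise \in Lfun P 2%:E -> h \o noise \in Lfun P 2%:E ->
  (forall g g' : fieldT, (forall t x, c (t, x) -> g t x = g' t x) -> f g = f g') ->
  (forall g g' : fieldT, (forall t x, ~~ c (t, x) -> g t x = g' t x) -> h g = h g') ->
  mean P (h \o noise) = 0 ->
  mean P (fun w => f (noise w) * h (noise w)) = 0.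
Proof.
move=> mf mh f2 h2 fc hc h0.
have mfh : measurable_fun setT (fun g : fieldT => (f g * h g)%:E).
  by apply/measurable_EFinP; exact: measurable_funM.
have L := @noise_glue c id id (@inj_id _) (@inj_id _).
have L' : same_law P noise (P \x P)%E (glue c id id) by move=> A mA; rewrite L.
have i1 : P.-integrable setT (fun w => (f (noise w) * h (noise w))%:E).
  by apply: Lfun1_EFin; exact: Lfun2M.
have mg := measurable_glue c id id; have mn := measurable_noise.
have i2 := same_law_integrable mn mg L' mfh i1.
have e2 := same_law_integral mn mg L' mfh i1.
rewrite /mean /= in e2 *; rewrite e2.
have fhE w : f (glue c id id w) * h (glue c id id w) = f (noise w.1) * h (noise w.2).
  congr (_ * _); [apply: fc|apply: hc] => t x; rewrite /glue /=.
    by move=> ->.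
  by move=> /negbTE ->.
under eq_integral do rewrite fhE.
have i3 : (P \x P)%E.-integrable setT (fun w => (f (noise w.1) * h (noise w.2))%:E).
  by under eq_fun do rewrite -fhE.
rewrite -(integral12_prod_meas1 i3) /fubini_F /=.
under eq_integral => w _.
  under eq_integral do rewrite EFinM.
  rewrite integralZl//; last by apply: Lfun1_EFin; exact: Lfun2_Lfun1.
  rewrite (mean_EFin (Lfun2_Lfun1 h2)) h0 mule0.
  over.
by rewrite integral0.
Qed.

Lemma Lfun2_noise t x : (fun w => noise w t x) \in Lfun P 2%:E.
Proof. by case: Hxi => mxi _ _ ixi _; apply/Lfun2P; split; [exact: mxi|case: (ixi t x)]. Qed.

Lemma mean_noise t x : mean P (fun w => noise w t x) = 0.
Proof.
by case: Hxi => _ _ _ _ /(_ t x); rewrite unlock /mean => ->.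
Qed.

Lemma avgn_zero k x : avgn k (fun=> 0) x = 0.
Proof.
elim: k x => // k IH x; rewrite avgnS /avg /boxsum big1// => v _.
by rewrite IH mulr0.
Qed.

Lemma Lfun2_harness_term k x i : (fun w => harness_term (noise w) k x i) \in Lfun P 2%:E.
Proof. by apply: Lfun2B; apply: Lfun2_avgn => y; exact: Lfun2_noise. Qed.

Lemma Lfun2_harness_sum n x i : (fun w => harness_sum n (noise w) x i) \in Lfun P 2%:E.
Proof. by apply: Lfun2_sum => k; exact: Lfun2_harness_term. Qed.

Lemma mean_harness_term k x i : mean P (fun w => harness_term (noise w) k x i) = 0.
Proof.
rewrite meanB; try by apply: Lfun2_Lfun1; apply: Lfun2_avgn => y; exact: Lfun2_noise.
rewrite !mean_avgn; try by move=> y; exact: Lfun2_noise.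
by under eq_fun do rewrite mean_noise; rewrite !avgn_zero subrr.
Qed.

Lemma mean_harness_sum n x i : mean P (fun w => harness_sum n (noise w) x i) = 0.
Proof.
rewrite mean_sum; last by move=> k; apply: Lfun2_Lfun1; exact: Lfun2_harness_term.
by rewrite big1// => k _; exact: mean_harness_term.
Qed.

(** * Loss of energy under averaging and summability of the variances *)

Let V k x := mean P (fun w => avgn k (noise w 0) x ^+ 2).
Let q k x y := mean P (fun w => (avgn k (noise w 0) x - avgn k (noise w 0) y) ^+ 2).

Let L2A k x : (fun w => avgn k (noise w 0) x) \in Lfun P 2%:E.
Proof. by apply: Lfun2_avgn => y; exact: Lfun2_noise. Qed.

Lemma mean_reindex (s : int * site d -> int * site d) (f : fieldT -> R) :
  injective s -> measurable_fun setT f -> (forall g, 0 <= f g) ->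
  mean P (fun w => f (fun t x => noise w (s (t, x)).1 (s (t, x)).2)) =
  mean P (f \o noise).
Proof.
move=> s_inj mf f0; rewrite /mean; congr fine.
apply: (same_law_ge0_integral _ measurable_noise (noise_reindex s_inj) (F := EFin \o f)).
- by apply: measurable_field => t x; case: Hxi => mxi _ _ _ _; exact: mxi.
- exact/measurable_EFinP.
- by move=> g; rewrite lee_fin.
Qed.

Let V0 k x : V k x = V k 0.
Proof.
have sinj : injective (fun tx : int * site d => (tx.1, tx.2 + x)).
  by move=> [t y] [t' y'] [-> /addIr ->].
have := @mean_reindex _ (fun g => avgn k (g 0) 0 ^+ 2) sinj.
rewrite /V /comp => <- //; last 2 first.
- by apply: measurable_funX; apply: (@measurable_avgn _ _ _ _ _ fieldT) => y; exact: measurable_field_coord.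
- by move=> g; exact: sqr_ge0.
congr mean; apply/funext => w /=; congr (_ ^+ _).
have := avgn_shift M p k (noise w 0) (- x) 0; rewrite opprK add0r => <-.
by congr (avgn k _ 0); apply/funext => z; rewrite opprK.
Qed.


(** This is [weighted_variance] inside the expectation: the squared deviation of the values at
    [x + v] from their average at [x] is the energy lost in one averaging. By [V0] the site drops
    out, and the weights sum to 1. *)
Let VB k x :
  boxsum M (fun v => p v * mean P (fun w => (avgn k (noise w 0) (x + v) - avgn k.+1 (noise w 0) x) ^+ 2))
  = V k 0 - V k.+1 0.
Proof.
have p1 : boxsum M p = 1 by case: Hp.
have m1 (F : site d -> Omega -> R) : (forall v, F v \in Lfun P 2%:E) ->
    boxsum M (fun v => p v * mean P (fun w => F v w ^+ 2)) =
    mean P (fun w => boxsum M (fun v => p v * F v w ^+ 2)).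
  move=> F2; rewrite /boxsum mean_sum; last by move=> v; apply/Lfun1Z/Lfun2X.
  by apply: eq_bigr => v _; rewrite meanZ//; apply: Lfun2X.
rewrite m1; last by move=> v; exact: Lfun2B.
under eq_fun do rewrite (weighted_variance (fun v => avgn k (noise _ 0) (x + v)) p1).
rewrite meanB; last 2 first.
- by apply: Lfun1_sum => v; apply/Lfun1Z/Lfun2X.
- by apply: Lfun2X; exact: (L2A k.+1 x).
rewrite -m1// -(V0 k.+1 x); congr (_ - _).
rewrite /boxsum (eq_bigr (fun e : {ffun 'I_d -> 'I_(M.*2).+1} => p (\row_j ((e j)%:Z - M%:Z)) * V k 0)).
  by rewrite -mulr_suml -/(boxsum M p) p1 mul1r.
by move=> v _; congr (_ * _); exact: V0.
Qed.

Let supp_box v : 0 < p v -> forall j, `|v 0 j| <= M%:Z.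
Proof.
move=> pv j; rewrite leNgt; apply/negP => Mv; case: Hp => _ /(_ v) pv0 _.
by move: pv; rewrite pv0 ?ltxx//; exists j.
Qed.

(** The summands in [VB] are nonnegative, so the one for [v] is at most V k - V (k+1); these
    differences telescope to at most V 0. *)
Let step_bound v x n : 0 < p v ->
  \sum_(0 <= k < n) mean P (fun w => (avgn k (noise w 0) (x + v) - avgn k.+1 (noise w 0) x) ^+ 2)
  <= (p v)^-1 * V 0 0.
Proof.
move=> pv; rewrite ler_pdivlMl// mulr_sumr.
have p0 u : 0 <= p u by case: Hp => /(_ u)[].
apply: (@le_trans _ _ (\sum_(0 <= k < n) (V k 0 - V k.+1 0))).
  apply: ler_sum => k _; rewrite -(VB k x).
  apply: (box_ge (F := fun u => p u * _)); last exact: supp_box.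
  by move=> u; rewrite mulr_ge0// mean_ge0// => w; exact: sqr_ge0.
rewrite (@telescope_sumr_eq _ 0 n (fun k => - V k 0))//; last by move=> k _; rewrite opprK addrC.
by rewrite opprK addrC lerBlDr lerDl mean_ge0// => w; exact: sqr_ge0.
Qed.

(** Directions along which the squared increments of the averages are summable in k, with a bound
    uniform in the site. Uniformity lets base points move, so these directions form a subgroup of
    the lattice. *)
Let bounded_dir y := exists C : R, forall x n, \sum_(0 <= k < n) q k (x + y) x <= C.

Let qC k x y : q k x y = q k y x.
Proof. by rewrite /q; congr mean; apply/funext => w; rewrite -opprB sqrrN. Qed.

Let qD k x y z : q k x z <= 2 * (q k x y + q k y z).
Proof.
rewrite [leLHS](_ : _ = mean P (fun w =>
    ((avgn k (noise w 0) x - avgn k (noise w 0) y) +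
     (avgn k (noise w 0) y - avgn k (noise w 0) z)) ^+ 2)); last first.
  by congr mean; apply/funext => w; rewrite subrKA.
by apply: mean_sqr_D_le; exact: Lfun2B.
Qed.

Let sumqD n x y z : \sum_(0 <= k < n) q k x z <=
  2 * (\sum_(0 <= k < n) q k x y + \sum_(0 <= k < n) q k y z).
Proof. by rewrite -big_split mulr_sumr; apply: ler_sum => k _; exact: qD. Qed.

Let bounded_dir0 : bounded_dir 0.
Proof.
exists 0 => x n; rewrite big1// => k _; rewrite /q addr0.
by under eq_fun do rewrite subrr expr0n; rewrite /mean integral0.
Qed.

Let bounded_dirN y : bounded_dir y -> bounded_dir (- y).
Proof.
move=> [C Cy]; exists C => x n; under eq_bigr do rewrite qC.
by have := Cy (x - y) n; rewrite subrK.
Qed.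

Let bounded_dirD y z : bounded_dir y -> bounded_dir z -> bounded_dir (y + z).
Proof.
move=> [C Cy] [D Dz]; exists (2 * (D + C)) => x n.
apply: le_trans (sumqD n _ (x + y) _) _; rewrite ler_pM2l// addrA lerD//.
Qed.

(** Both x + (v - u) and x are one step of the walk from x - u, by v and by u; each value is
    compared with the average at x - u. *)
Let bounded_dir_supp v u : 0 < p v -> 0 < p u -> bounded_dir (v - u).
Proof.
move=> pv pu; exists (2 * ((p v)^-1 * V 0 0 + (p u)^-1 * V 0 0)) => x n.
have := step_bound (x - u) n pv; have := step_bound (x - u) n pu.
rewrite subrK addrAC -addrA => Hu Hv.
have := lerD Hv Hu; rewrite -(@ler_pM2l _ 2)//; apply: le_trans.
rewrite -big_split mulr_sumr; apply: ler_sum => k _ /=.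
rewrite [leLHS](_ : _ = mean P (fun w =>
    ((avgn k (noise w 0) (x + (v - u)) - avgn k.+1 (noise w 0) (x - u)) +
     (avgn k.+1 (noise w 0) (x - u) - avgn k (noise w 0) x)) ^+ 2)); last first.
  by congr mean; apply/funext => w; rewrite subrKA.
apply: le_trans (mean_sqr_D_le _ _) _; [exact: Lfun2B|exact: Lfun2B|].
rewrite ler_pM2l// lerD2l le_eqVlt; apply/orP; left; apply/eqP.
by congr mean; apply/funext => w; rewrite -opprB sqrrN.
Qed.

Let bounded_dirM y (n : int) : bounded_dir y -> bounded_dir (y *~ n).
Proof.
move=> By; have Bn m : bounded_dir (y *+ m).
  by elim: m => [|m IH]; rewrite ?mulr0n// mulrS; exact: bounded_dirD.
by case: n => m; rewrite ?NegzE ?mulrNz; [|apply: bounded_dirN]; exact: Bn.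
Qed.

Let bounded_dir_all y : bounded_dir y.
Proof.
have [w0 pw0] : exists w, 0 < p w.
  apply: contrapT => /forallNP np; case: Hp => pge _ p1.
  have : boxsum M p = 0.
    rewrite /boxsum big1// => k _; apply/eqP; rewrite eq_le (pge _).1 andbT leNgt.
    by apply/negP/np.
  by rewrite p1; apply/eqP; rewrite oner_eq0.
(* The shift by [- w0] makes the generators differences of points of the support, which are bounded
   directions. *)
have [s [/allP sp ->]] := Hap (- w0) y.
rewrite big_seq; elim/big_rec: _ => // c z cs Bz.
apply: bounded_dirD => //; apply: bounded_dirM; rewrite addrC.
by apply: bounded_dir_supp => //; exact: sp.
Qed.

Definition sumvar n x i := \sum_(0 <= k < n) mean P (fun w => harness_term (noise w) k x i ^+ 2).

Lemma sumvar_bounded i : exists C : R, forall x n, sumvar n x i <= C.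
Proof.
have [C HC] := bounded_dir_all (- unit_e i); exists C => x n.
apply: le_trans (HC x n); apply: ler_sum => k _; rewrite qC le_eqVlt; apply/orP; left.
(* The k-th term reads the noise at time -k, whereas [q] uses time 0; a time shift preserves the
   law. *)
have sinj : injective (fun tx : int * site d => (tx.1 - k%:Z, tx.2)).
  by move=> [t y] [t' y'] [/addIr -> ->].
have := @mean_reindex _ (fun g => (avgn k (g 0) x - avgn k (g 0) (x - unit_e i)) ^+ 2) sinj.
rewrite /q /comp => <- //; last 2 first.
- by apply: measurable_funX; apply: measurable_funB; apply: (@measurable_avgn _ _ _ _ _ fieldT) => y; exact: measurable_field_coord.
- by move=> g; exact: sqr_ge0.
by apply/eqP; congr mean; apply/funext => w; rewrite /harness_term /= sub0r.
Qed.

(** * Orthogonality of the terms and the maximal inequality *)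

Definition totvar x i := limn (fun n => sumvar n x i).

Let term_var_ge0 k x i : 0 <= mean P (fun w => harness_term (noise w) k x i ^+ 2).
Proof. by apply: mean_ge0 => w; exact: sqr_ge0. Qed.

Lemma sumvar_cvg x i : sumvar n x i @[n --> \oo] --> totvar x i.
Proof.
apply: nondecreasing_is_cvgn.
  by apply/nondecreasing_seqP => n; rewrite /sumvar big_nat_recr//= lerDl.
by have [C HC] := sumvar_bounded i; exists C => _ [n _ <-].
Qed.

Lemma sumvar_le x i n : sumvar n x i <= totvar x i.
Proof.
apply: nondecreasing_cvgn_le; last exact: sumvar_cvg.
by apply/nondecreasing_seqP => m; rewrite /sumvar big_nat_recr//= lerDl.
Qed.

(** The k-th term reads only the noise at time -k and has mean zero, while [f] reads only later
    times; [mean_block_orthogonal] applies to the block of times above -k. *)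
Let future_orthogonal k x i (f : fieldT -> R) : measurable_fun setT f ->
  f \o noise \in Lfun P 2%:E ->
  (forall g g' : fieldT, (forall t y, - k%:Z < t -> g t y = g' t y) -> f g = f g') ->
  mean P (fun w => f (noise w) * harness_term (noise w) k x i) = 0.
Proof.
move=> mf f2 fc.
apply: (@mean_block_orthogonal (fun tx => - k%:Z < tx.1) f (fun g => harness_term g k x i)) => //.
- exact: measurable_harness_term.
- exact: Lfun2_harness_term.
- by move=> g g' gg'; rewrite /harness_term (_ : g (- k%:Z) = g' (- k%:Z))//;
    apply/funext => y; apply: gg'; rewrite /= ltxx.
- exact: mean_harness_term.
Qed.

Lemma harness_sum_local n x i (g g' : fieldT (d := d)) :
  (forall t y, - n%:Z < t <= 0 -> g t y = g' t y) -> harness_sum n g x i = harness_sum n g' x i.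
Proof.
move=> gg'; apply: eq_big_nat => k /= kn; rewrite /harness_term.
rewrite (_ : g (- k%:Z) = g' (- k%:Z))//; apply/funext => y; apply: gg'.
by rewrite ltrN2 ltz_nat kn oppr_le0.
Qed.

(** Pythagoras: term [n] is orthogonal to the sum of the preceding ones, which reads only times
    above -n. *)
Lemma mean_harness_sum_sqr n x i :
  mean P (fun w => harness_sum n (noise w) x i ^+ 2) = sumvar n x i.
Proof.
elim: n => [|n IH].
  rewrite /sumvar big_nil /mean; under eq_integral do rewrite /harness_sum big_nil expr0n.
  by rewrite integral0.
rewrite /sumvar big_nat_recr//= -/(sumvar n x i) -IH.
rewrite -(mean_sqrD (f := fun w => harness_sum n (noise w) x i)).
- by congr mean; apply/funext => w; rewrite {1}/harness_sum big_nat_recr.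
- exact: Lfun2_harness_sum.
- exact: Lfun2_harness_term.
apply: (future_orthogonal _ _ (f := fun g => harness_sum n g x i)).
- exact: measurable_harness_sum.
- exact: Lfun2_harness_sum.
- by move=> g g' gg'; apply: harness_sum_local => t y /andP[/gg'].
Qed.

(* [harness_sum (m + j) - harness_sum m], frozen at the first [j] where it reaches [e] in absolute value. *)
Fixpoint stopped m (e : R) x i (g : fieldT (d := d)) j : R :=
  if j is j'.+1 then
    let s := stopped m e x i g j' in
    s + (`|s| < e)%R%:R * harness_term g (m + j') x i
  else 0.

Lemma measurable_stopped m e x i j : measurable_fun setT (fun g => stopped m e x i g j).
Proof.
elim: j => [|j IH] /=; first exact: measurable_cst.
apply: measurable_funD => //; apply: measurable_funM; last exact: measurable_harness_term.
rewrite (_ : (fun g => _) = (fun b : bool => b%:R) \o (fun g => `|stopped m e x i g j| < e))//.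
apply: measurableT_comp => //.
by apply: measurable_fun_ltr => //; exact: measurableT_comp.
Qed.

Lemma stopped_local m e x i j (g g' : fieldT (d := d)) :
  (forall t y, - (m + j)%N%:Z < t -> g t y = g' t y) ->
  stopped m e x i g j = stopped m e x i g' j.
Proof.
elim: j => //= j IH gg'.
rewrite IH; last by move=> t y ty; apply: gg'; rewrite (lt_trans _ ty)// ltrN2 ltz_nat addnS.
rewrite /harness_term (_ : g (- (m + j)%N%:Z) = g' (- (m + j)%N%:Z))//.
by apply/funext => y; apply: gg'; rewrite ltrN2 ltz_nat addnS.
Qed.

Let Lfun2_dom (f h : Omega -> R) : measurable_fun setT f -> h \in Lfun P 2%:E ->
  (forall w, f w ^+ 2 <= h w ^+ 2) -> f \in Lfun P 2%:E.
Proof.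
move=> mf /Lfun2P[mh ih] fh; apply/Lfun2P; split => //.
apply: (le_integrable _ _ _ ih) => //; first by apply/measurable_EFinP/measurable_funX.
by move=> w _; rewrite /= lee_fin !ger0_norm ?sqr_ge0.
Qed.

Let bool_sqr (b : bool) (a : R) : (b%:R * a) ^+ 2 <= a ^+ 2.
Proof. by case: b; rewrite ?mul1r// mul0r expr0n sqr_ge0. Qed.

Let measurable_stop m e x i j :
  measurable_fun setT (fun g => (`|stopped m e x i g j| < e)%R%:R : R).
Proof.
rewrite (_ : (fun g => _) = (fun b : bool => b%:R) \o (fun g => `|stopped m e x i g j| < e))//.
apply: measurableT_comp => //.
by apply: measurable_fun_ltr => //; apply: measurableT_comp => //; exact: measurable_stopped.
Qed.

Let Lfun2_stopped_term m e x i j : (fun w => (`|stopped m e x i (noise w) j| < e)%R%:R *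
  harness_term (noise w) (m + j) x i) \in Lfun P 2%:E.
Proof.
apply: (Lfun2_dom _ (Lfun2_harness_term (m + j) x i)) => [|w]; last exact: bool_sqr.
apply: measurable_funM; last exact/Lfun2_measurable/Lfun2_harness_term.
by apply: (measurableT_comp (measurable_stop m e x i j)); exact: measurable_noise.
Qed.

Lemma Lfun2_stopped m e x i j : (fun w => stopped m e x i (noise w) j) \in Lfun P 2%:E.
Proof. by elim: j => [|j IH] /=; [exact: Lfun_cst|exact: Lfun2D]. Qed.

(** Whether the sum is already frozen depends only on times above -(m + j), so the next increment is
    orthogonal to the stopped sum, and the indicator can only decrease its second moment. *)
Lemma mean_stopped_sqr m e x i j :
  mean P (fun w => stopped m e x i (noise w) j ^+ 2) <= sumvar (m + j) x i - sumvar m x i.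
Proof.
elim: j => [|j IH] /=.
  by rewrite addn0 subrr /mean; under eq_integral do rewrite expr0n; rewrite integral0.
rewrite mean_sqrD; last 3 first.
- exact: Lfun2_stopped.
- exact: Lfun2_stopped_term.
- under eq_fun do rewrite mulrA.
  apply: (future_orthogonal _ _
    (f := fun g => stopped m e x i g j * (`|stopped m e x i g j| < e)%R%:R)).
  + by apply: measurable_funM; [exact: measurable_stopped|exact: measurable_stop].
  + apply: (Lfun2_dom _ (Lfun2_stopped m e x i j)) => [|w /=]; last by rewrite mulrC bool_sqr.
    apply: measurable_funM; first exact/Lfun2_measurable/Lfun2_stopped.
    by apply: (measurableT_comp (measurable_stop m e x i j)); exact: measurable_noise.
  + by move=> g g' gg'; rewrite (stopped_local _ _ _ gg').
rewrite addnS {1}/sumvar big_nat_recr//= -/(sumvar (m + j) x i) addrAC lerD//.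
by apply: mean_le => [||w]; [exact/Lfun2X/Lfun2_stopped_term|exact/Lfun2X/Lfun2_harness_term|exact: bool_sqr].
Qed.

(** A stopped sum below [e] has never been frozen, since a frozen one keeps a value of size at least
    [e]. *)
Lemma stoppedP m e x i g j : 0 < e -> `|stopped m e x i g j| < e ->
  stopped m e x i g j = harness_sum (m + j) g x i - harness_sum m g x i.
Proof.
move=> e0; elim: j => [|j IH] /=; first by rewrite addn0 subrr.
case: (ltP `|stopped m e x i g j| e) => [sj|sj]; last by rewrite mul0r addr0 ltNge sj.
by move=> _; rewrite IH// mul1r addnS [in RHS]/harness_sum big_nat_recr//= addrAC.
Qed.

Let stopped_mono m e x i g j k : (j <= k)%N -> e <= `|stopped m e x i g j| ->
  e <= `|stopped m e x i g k|.
Proof.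
move=> /subnK <-; elim: (k - j)%N => // l IH sj; rewrite addSn /=.
by move: (IH sj); rewrite leNgt => /negbTE /[dup] H ->; rewrite mul0r addr0 leNgt H.
Qed.

Definition escape m e x i : set Omega :=
  \bigcup_j [set w | e <= `|stopped m e x i (noise w) j|].

Let measurable_escape1 m e x i j : measurable [set w | e <= `|stopped m e x i (noise w) j|].
Proof.
rewrite -[X in measurable X]setTI.
apply: (measurable_fun_ler (D := setT)) => //; apply: measurableT_comp => //.
exact/Lfun2_measurable/Lfun2_stopped.
Qed.

Lemma measurable_escape m e x i : measurable (escape m e x i).
Proof. by apply: bigcup_measurable => j _. Qed.

(* Kolmogorov's maximal inequality: Chebyshev's inequality for the stopped sums. *)
Lemma escape_prob m e x i : 0 < e ->
  ((e ^+ 2)%:E * P (escape m e x i) <= (totvar x i - sumvar m x i)%:E)%E.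
Proof.
move=> e0.
have H j : (P [set w | (e <= `|stopped m e x i (noise w) j|)%R] <=
    ((totvar x i - sumvar m x i) / e ^+ 2)%:E)%E.
  rewrite mulrC EFinM lee_pdivlMl ?exprn_gt0//.
  apply: le_trans (chebyshev_bound P (Lfun2_measurable (Lfun2_stopped m e x i j)) e0) _.
  rewrite mean_EFin ?lee_fin; last exact/Lfun2X/Lfun2_stopped.
  by apply: le_trans (mean_stopped_sqr m e x i j) _; rewrite lerD2r sumvar_le.
rewrite -lee_pdivlMl ?exprn_gt0// -EFinM mulrC.
have := @nondecreasing_cvg_mu _ _ _ P _ (measurable_escape1 m e x i)
  (measurable_escape m e x i).
move=> /(_ _)/cvg_lim <- //; last first.
  by move=> j k jk; apply/subsetPset => w /=; exact: stopped_mono.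
apply: lime_le; last by apply: nearW => j; exact: H.
apply: ereal_nondecreasing_is_cvgn => j k jk /=; apply: le_measure; rewrite ?inE//.
by move=> w /=; exact: stopped_mono.
Qed.

Lemma not_escape m e x i w : 0 < e -> ~ escape m e x i w ->
  forall j, `|harness_sum (m + j) (noise w) x i - harness_sum m (noise w) x i| < e.
Proof.
move=> e0 nw j; have sj : `|stopped m e x i (noise w) j| < e.
  by rewrite ltNge; apply/negP => H; apply: nw; exists j.
by rewrite -(stoppedP e0 sj).
Qed.

(** * Convergence of the series almost surely and its second moment *)

Notation harness_lim := (harness_lim M p).
Notation harness_cvg := (harness_cvg M p).

Lemma escape_cvg0 e x i : 0 < e -> P (escape m e x i) @[m --> \oo] --> 0%E.
Proof.
move=> e0; have e20 : 0 < e ^+ 2 by rewrite exprn_gt0.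
apply: (@squeeze_cvge _ _ _ _ (fun=> 0%E) _
    (fun m => ((e ^+ 2)^-1 * (totvar x i - sumvar m x i))%:E)).
- apply: nearW => m; rewrite measure_ge0/= EFinM.
  by rewrite lee_pdivlMl// escape_prob.
- exact: cvg_cst.
- apply: cvg_EFin; first exact: nearW.
  rewrite -(mulr0 (e ^+ 2)^-1) -(subrr (totvar x i)) /comp/=.
  apply: cvgM; first exact: cvg_cst.
  by apply: cvgB; [exact: cvg_cst|exact: sumvar_cvg].
Qed.

Lemma measurable_harness_cvg : measurable [set g : fieldT | harness_cvg g].
Proof.
rewrite (_ : [set g | _] = [set g : fieldT | forall xj : site d * 'I_d,
    cvgn (fun n => harness_sum n g xj.1 xj.2)]).
  apply: (@measurable_forall_count _ fieldT) => -[x i] /=.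
  apply: (measurable_cvgn (u := fun n (g : fieldT) => harness_sum n g x i)) => n.
  exact: measurable_harness_sum.
apply/seteqP; split => g /= Hg; first by move=> [x i]; exact: Hg.
by move=> x i; exact: (Hg (x, i)).
Qed.

Lemma measurable_harness_lim x i : measurable_fun setT (fun g : fieldT => harness_lim g x i).
Proof.
apply: (measurable_limn (u := fun n (g : fieldT) => harness_sum n g x i)) => n.
exact: measurable_harness_sum.
Qed.

(** If the sums fail to converge, then for some site, direction and k they move by at least 1/(k+1)
    after every m. Such a path lies in all the events [escape m], whose probabilities tend to 0, and
    there are countably many choices of site, direction and k. *)
Lemma noise_ncvg : P (noise @^-1` ~` [set g : fieldT | harness_cvg g]) = 0%E.
Proof.
pose inve k : R := k.+1%:R^-1.
pose N n := if (unpickle n : option (site d * 'I_d * nat)) is Some (x, i, k)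
  then \bigcap_m escape m (inve k) x i else set0.
have mN n : measurable (N n).
  rewrite /N; case: unpickle => [[[x i] k]|]; last exact: measurable0.
  by apply: bigcap_measurableType => m _; exact: measurable_escape.
have N0 n : P.-negligible (N n).
  apply/negligibleP => //; rewrite /N; case: unpickle => [[[x i] k]|]; last exact: measure0.
  apply/eqP; rewrite eq_le measure_ge0 andbT.
  have k0 : 0 < inve k by rewrite invr_gt0.
  have /cvg_lim <- // := escape_cvg0 x i k0.
  apply: lime_ge; first by apply: cvgP; exact: escape_cvg0.
  apply: nearW => m; apply: le_measure; rewrite ?inE.
  - by apply: bigcap_measurableType => m' _; exact: measurable_escape.
  - exact: measurable_escape.
  - exact: bigcap_inf.
apply/negligibleP.
  rewrite -[X in measurable X]setTI; apply: measurable_noise => //.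
  by apply: measurableC; exact: measurable_harness_cvg.
apply: negligibleS (negligible_bigcup N0) => w /= ncw; apply: contrapT => nN; apply: ncw.
move=> x i; apply/cvgn_cauchyP => k.
have : ~ N (pickle (x, i, k)) w by move=> H; apply: nN; exists (pickle (x, i, k)).
rewrite /N pickleK => /existsNP[m /not_implyP[_ nm]].
by exists m; apply: not_escape => //; rewrite invr_gt0.
Qed.

Lemma harness_lim_cvg_prob x i (e : R) : 0 < e ->
  P [set w | e <= `|harness_lim (noise w) x i - harness_sum m (noise w) x i|] @[m --> \oo]
  --> 0%E.
Proof.
move=> e0; have e20 : 0 < e / 2 by rewrite divr_gt0.
have mlim : measurable_fun setT (fun w => harness_lim (noise w) x i).
  exact: (measurableT_comp (measurable_harness_lim x i) measurable_noise).
apply: (@squeeze_cvge _ _ _ _ (fun=> 0%E) _ (fun m => P (escape m (e / 2) x i))).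
- apply: nearW => m; rewrite measure_ge0/=.
  set N := noise @^-1` ~` [set g : fieldT | harness_cvg g].
  have mN : measurable N.
    rewrite -[X in measurable X]setTI; apply: measurable_noise => //.
    by apply: measurableC; exact: measurable_harness_cvg.
  rewrite -[leRHS]adde0 -noise_ncvg -/N.
  apply: le_trans (measureU2 _ (measurable_escape m (e / 2) x i) mN).
  apply: le_measure; rewrite ?inE.
  + rewrite -[X in measurable X]setTI; apply: (measurable_fun_ler (D := setT)) => //.
    apply: measurableT_comp => //; apply: measurable_funB => //.
    exact/Lfun2_measurable/Lfun2_harness_sum.
  + by apply: measurableU => //; exact: measurable_escape.
  move=> w /=; apply: contraPP => /not_orP[nw /contrapT cw]; apply/negP; rewrite -ltNge.
  have ne := not_escape e20 nw.
  (* The strict bound of [not_escape] becomes weak in the limit; taking it at e / 2 keeps the limit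
     strictly below e. *)
  apply: (@le_lt_trans _ _ (e / 2)); last by rewrite ltr_pdivrMr// mulr_natr mulr2n ltrDl.
  have cn : (fun j => `|harness_sum (m + j) (noise w) x i - harness_sum m (noise w) x i|) @ \oo -->
     `|harness_lim (noise w) x i - harness_sum m (noise w) x i|.
    apply: cvg_norm; apply: cvgB; last exact: cvg_cst.
    have cwl : (fun n => harness_sum n (noise w) x i) @ \oo --> harness_lim (noise w) x i.
      exact: cw.
    rewrite -(cvg_shiftn m) in cwl.
    by rewrite (_ : (fun j => _) = [sequence harness_sum (n + m) (noise w) x i]_n)//;
      apply/funext => j; rewrite addnC.
  rewrite -(cvg_lim (@norm_hausdorff _ _) cn); apply: limr_le; first exact: cvgP cn.
  by apply: nearW => j; exact/ltW.
- exact: cvg_cst.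
- exact: escape_cvg0.
Qed.

(** Fatou's lemma along the partial sums, whose second moments are [sumvar] and hence at most
    [totvar]. *)
Lemma harness_lim_sqr_le x i :
  (\int[P]_w (harness_lim (noise w) x i ^+ 2)%:E <= (totvar x i)%:E)%E.
Proof.
pose f n w := (harness_sum n (noise w) x i ^+ 2)%:E.
have mf n : measurable_fun setT (f n).
  by apply/measurable_EFinP/measurable_funX/Lfun2_measurable/Lfun2_harness_sum.
have mlim : measurable_fun setT (fun w => harness_lim (noise w) x i).
  exact: (measurableT_comp (measurable_harness_lim x i) measurable_noise).
apply: (@le_trans _ _ (\int[P]_w limn_einf (f^~ w))%E).
  apply: ae_ge0_le_integral => //.
  - by move=> w _; rewrite lee_fin sqr_ge0.
  - by apply/measurable_EFinP/measurable_funX.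
  - move=> w _; rewrite limn_einf_lim; apply: lime_ge; first exact: is_cvg_einfs.
    apply: nearW => n; apply: le_ereal_inf_tmp => _ [m _ <-].
    by rewrite lee_fin sqr_ge0.
  - rewrite (_ : (fun w => _) = fun w => (- limn_esup (fun n => - f n w))%E).
      apply: measurableT_comp => //; apply: measurable_fun_limn_esup => n.
      exact: measurableT_comp.
    apply/funext => w; rewrite -limn_einfN; congr limn_einf.
    by apply/funext => n; rewrite /= opprK.
  have mN : measurable (noise @^-1` ~` [set g : fieldT | harness_cvg g]).
    rewrite -[X in measurable X]setTI; apply: measurable_noise => //.
    by apply: measurableC; exact: measurable_harness_cvg.
  exists (noise @^-1` ~` [set g : fieldT | harness_cvg g]); split => //.
    exact: noise_ncvg.
  move=> w /=; apply: contra_not => cw _.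
  have fl : f^~ w @ \oo --> (harness_lim (noise w) x i ^+ 2)%:E.
    by apply: cvg_EFin; [exact: nearW|rewrite /comp/= /f expr2; apply: cvgM; exact: cw].
  by rewrite (is_cvg_limn_einfE (cvgP _ fl)) (cvg_lim _ fl).
apply: le_trans; first by apply: fatou => // n w _; rewrite lee_fin sqr_ge0.
have lef n : (\int[P]_w f n w <= (totvar x i)%:E)%E.
  rewrite /f mean_EFin; last exact/Lfun2X/Lfun2_harness_sum.
  by rewrite mean_harness_sum_sqr lee_fin sumvar_le.
rewrite limn_einf_lim; apply: lime_le.
  exact: is_cvg_einfs.
by apply: nearW => n; apply: le_trans (lef n); apply: ereal_inf_lbound; exists n => /=.
Qed.

Lemma Lfun2_harness_lim x i : (fun w => harness_lim (noise w) x i) \in Lfun P 2%:E.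
Proof.
apply/Lfun2P; split.
  exact: (measurableT_comp (measurable_harness_lim x i) measurable_noise).
apply/integrableP; split.
  apply/measurable_EFinP/measurable_funX.
  exact: (measurableT_comp (measurable_harness_lim x i) measurable_noise).
under eq_integral do rewrite /= ger0_norm ?sqr_ge0//.
exact: le_lt_trans (harness_lim_sqr_le x i) (ltry _).
Qed.

(** * The chain run for several steps *)

(** The state at time 0 of the chain started from [eta] at time -T and driven by [g]. *)
Definition flow T (eta : conf R d) (g : int -> site d -> R) : conf R d :=
  fun x i => avgn T (eta^~ i) x + harness_sum T g x i.

Lemma measurable_flow T :
  measurable_fun setT (fun z : confT R d * Omega => flow T z.1 (noise z.2) : confT R d).
Proof.
apply: measurable_conf => x i; apply: measurable_funD.
  apply: (@measurable_avgn _ _ _ _ _ (confT R d * Omega)%type T (fun z y => z.1 y i)) => y.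
  exact: (measurableT_comp (measurable_conf_coord y i) measurable_fst).
apply: (measurableT_comp (measurable_harness_sum M p T x i)).
exact: (measurableT_comp measurable_noise measurable_snd).
Qed.

Lemma measurable_flow_field T eta :
  measurable_fun setT (fun g : fieldT => flow T eta g : confT R d).
Proof.
apply: measurable_conf => x i; apply: measurable_funD; first exact: measurable_cst.
exact: measurable_harness_sum.
Qed.

Lemma measurable_chain :
  measurable_fun setT (fun z : confT R d * Omega =>
    chain_step M p z.1 (fun x => xi 1 x z.2) : confT R d).
Proof.
case: Hxi => mxi _ _ _ _.
apply: measurable_conf => x i; apply: measurable_funB; first apply: measurable_funD.
- apply: (@measurable_avgn _ _ _ _ _ (confT R d * Omega)%type 1 (fun z y => z.1 y i)) => y.
  exact: (measurableT_comp (measurable_conf_coord y i) measurable_fst).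
- exact: (measurableT_comp (mxi 1 x) measurable_snd).
- exact: (measurableT_comp (mxi 1 (x - unit_e i)) measurable_snd).
Qed.

(* The noise at time 0 is the time-1 noise of the second sample; at negative times it is the first sample
   advanced by one unit of time. Positive times play no role. *)
Let refresh := glue (fun tx => tx.1 != 0) (fun tx => (tx.1 + 1, tx.2)) (fun tx => (tx.1 + 1, tx.2)).

Let refresh_law : same_law (P \x P)%E refresh P noise.
Proof. by apply: noise_glue => -[t y] [t' y'] [/addIr -> ->]. Qed.

Let refresh0 w : refresh w 0 = fun x => xi 1 x w.2.
Proof. by apply/funext. Qed.

Let tshift_refresh w t y : t <= 0 -> tshift 1 (refresh w) t y = noise w.1 t y.
Proof.
by move=> t0; rewrite /tshift /refresh /glue /= subr_eq0 subrK (lt_eqF (le_lt_trans t0 _)).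
Qed.

Let chain_refresh T eta w w' :
  chain_step M p (flow T eta (noise w)) (fun x => xi 1 x w') = flow T.+1 eta (refresh (w, w')).
Proof.
transitivity (chain_step M p (fun x i => avgn T (eta^~ i) x +
    harness_sum T (tshift 1 (refresh (w, w'))) x i) (refresh (w, w') 0)); last first.
  exact: chain_harness.
rewrite refresh0; congr (chain_step M p _ _); apply/funext => x; apply/funext => i; congr (_ + _).
by apply: harness_sum_local => t y /andP[_ t0]; rewrite tshift_refresh.
Qed.

(** Induction on [T]. Invariance adds one chain step with fresh noise to the T-step flow; by
    [chain_refresh] the result is the flow of T + 1 steps driven by the glued field [refresh], which
    has the law of the noise. *)
Lemma flow_law (nu : probability (confT R d) R) : chain_invariant M p P xi nu ->
  forall T, same_law (nu \x P)%E (fun z => flow T z.1 (noise z.2) : confT R d) nu id.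
Proof.
move=> inv; elim=> [|T IH] B mB.
  rewrite (_ : _ @^-1` B = B `*` setT).
    by apply: etrans (product_measure1E nu P mB measurableT) _; rewrite [X in (_ * X)%E](probability_setT P) mule1.
  apply/seteqP; split => -[eta w] /=; rewrite /flow /harness_sum /=.
    by under eq_fun do under eq_fun do rewrite big_nil addr0.
  by case=> + _; under eq_fun do under eq_fun do rewrite big_nil addr0.
rewrite /= inv//.
pose S := (fun z : confT R d * Omega =>
    chain_step M p z.1 (fun x => xi 1 x z.2) : confT R d) @^-1` B.
have mS : measurable S by rewrite -[X in measurable X]setTI; exact: measurable_chain.
pose F eta := P (xsection S eta).
have mF : measurable_fun setT F by exact: measurable_fun_xsection.
have FE eta : P [set w | B (chain_step M p eta (fun x => xi 1 x w))] = F eta.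
  by congr (P _); apply/seteqP; split => w; rewrite /xsection /= inE.
under eq_integral do rewrite FE.
rewrite -(same_law_ge0_integral (measurable_flow T) _ IH mF (fun _ => measure_ge0 _ _)) //.
rewrite fubini_tonelli1//; last 1 first.
  by apply: (measurableT_comp mF); exact: measurable_flow.
apply: eq_integral => eta _; rewrite /fubini_F /=.
pose G := (fun g : fieldT => flow T.+1 eta g : confT R d) @^-1` B.
have mG : measurable G by rewrite -[X in measurable X]setTI; exact: measurable_flow_field.
transitivity (P (noise @^-1` G)).
  by congr (P _); apply/seteqP; split => w; rewrite /xsection /= inE.
rewrite -(refresh_law mG) /=.
apply: eq_integral => w _; rewrite -FE; congr (P _); apply/seteqP; split => w';
  by rewrite /xsection /= inE chain_refresh.
Qed.

(** * Deterministic configurations plus the series: invariance and extremality *)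

Definition limit_conf (m : site d -> 'I_d -> R) (g : int -> site d -> R) : conf R d :=
  fun x i => m x i + harness_lim g x i.

Lemma measurable_limit_conf m :
  measurable_fun setT (fun g : fieldT => limit_conf m g : confT R d).
Proof.
apply: measurable_conf => x i; apply: measurable_funD; first exact: measurable_cst.
exact: measurable_harness_lim.
Qed.

Lemma measurable_limit_noise m :
  measurable_fun setT (fun w => limit_conf m (noise w) : confT R d).
Proof. exact: (measurableT_comp (measurable_limit_conf m) measurable_noise). Qed.

Lemma XconfE u : Xconf M p xi u = fun w => limit_conf (fun x i => u i x) (noise w).
Proof.
apply/funext => w; apply/funext => x; apply/funext => i.
by rewrite /Xconf Delta0E.
Qed.

(** For every [T] the flow has law [nu], and it converges in probability at each coordinate to
    [limit_conf m]: the averages to [m] by assumption, the partial sums to the series. A sequence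
    with constant law has the law of its limit. *)
Lemma invariant_limit (nu : probability (confT R d) R) (m : site d -> 'I_d -> R) :
  chain_invariant M p P xi nu ->
  (forall x i e, 0 < e ->
    nu [set eta | e <= `|avgn T (eta^~ i) x - m x i|] @[T --> \oo] --> 0%E) ->
  is_law P nu (fun w => limit_conf m (noise w)).
Proof.
move=> inv Hm; have FL := flow_law inv.
pose X T (xj : site d * 'I_d) (z : confT R d * Omega) := flow T z.1 (noise z.2) xj.1 xj.2.
pose Y (xj : site d * 'I_d) (z : confT R d * Omega) := limit_conf m (noise z.2) xj.1 xj.2.
have mX T xj : measurable_fun setT (X T xj).
  exact: (measurableT_comp (measurable_conf_coord xj.1 xj.2) (measurable_flow T)).
have mYw xj : measurable_fun setT (fun w => limit_conf m (noise w) xj.1 xj.2).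
  exact: (measurableT_comp (measurable_conf_coord xj.1 xj.2) (measurable_limit_noise m)).
have mY xj : measurable_fun setT (Y xj).
  exact: (measurableT_comp (mYw xj) measurable_snd).
have nuX T l : (nu \x P)%E (orthant (X T) l) = nu (orthant conf_coord l).
  have mo : measurable (orthant (T := confT R d) conf_coord l).
    by apply: measurable_orthant => -[x i]; exact: measurable_conf_coord.
  by rewrite -(FL T _ mo); congr ((nu \x P)%E _).
have PY l : (nu \x P)%E (orthant Y l) =
    P (orthant (fun xj w => limit_conf m (noise w) xj.1 xj.2) l).
  rewrite (_ : orthant Y l = setT `*` orthant (fun xj w => limit_conf m (noise w) xj.1 xj.2) l).
    rewrite product_measure1E//=; last exact: measurable_orthant.
    by rewrite probability_setT mul1e.
  by apply/seteqP; split => -[eta w]; rewrite /orthant /=; [|case].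
apply: (@same_law_orthant _ _ _ _ _ _ (confT R d) nu id P _ _ conf_coord) => //.
- exact: measurable_limit_noise.
- exact: confT_gen.
move=> l; apply: etrans (esym (nuX 0%N l)) _; apply: etrans _ (PY l).
apply: (orthant_cvg_prob mX mY); last by move=> n l'; exact: etrans (nuX n l') (esym (nuX 0%N l')).
move=> [x i] e e0; have e20 : 0 < e / 2 by rewrite divr_gt0.
have mA T : measurable [set eta : confT R d | e / 2 <= `|avgn T (eta^~ i) x - m x i|].
  rewrite -[X in measurable X]setTI; apply: (measurable_fun_ler (D := setT)) => //.
  apply: measurableT_comp => //; apply: measurable_funB => //.
  apply: (@measurable_avgn _ _ _ _ _ (confT R d) T (fun z y => z y i)) => y.
  exact: measurable_conf_coord.
have mB T : measurable [set w | e / 2 <= `|harness_lim (noise w) x i - harness_sum T (noise w) x i|].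
  rewrite -[X in measurable X]setTI; apply: (measurable_fun_ler (D := setT)) => //.
  apply: measurableT_comp => //; apply: measurable_funB.
    exact: (measurableT_comp (measurable_harness_lim x i) measurable_noise).
  exact/Lfun2_measurable/Lfun2_harness_sum.
apply: (@squeeze_cvge _ _ _ _ (fun=> 0%E) _ (fun T =>
    nu [set eta | (e / 2 <= `|avgn T (eta^~ i) x - m x i|)%R] +
    P [set w | (e / 2 <= `|harness_lim (noise w) x i - harness_sum T (noise w) x i|)%R])%E).
- apply: nearW => T; rewrite measure_ge0/=.
  rewrite -[X in (_ <= X + _)%E]mule1 -(probability_setT P) -product_measure1E//.
  rewrite -[X in (_ <= _ + X)%E]mul1e -(probability_setT nu) -product_measure1E//.
  apply: le_trans (measureU2 _ _ _); last 2 first.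
  + exact: measurableX.
  + exact: measurableX.
  apply: le_measure; rewrite ?inE.
  + rewrite -[X in measurable X]setTI; apply: (measurable_fun_ler (D := setT)) => //.
    by apply: measurableT_comp => //; exact: measurable_funB.
  + by apply: measurableU; exact: measurableX.
  move=> [eta w] /=; rewrite /X /Y /flow /limit_conf /= => H; apply: contrapT => /not_orP[n1 n2].
  move: n1 n2; have [//|h1 _] := leP (e / 2) `|avgn T (eta^~ i) x - m x i|.
    by move=> H1 []; split.
  have [H2 []|h2 _] := leP (e / 2) `|harness_lim (noise w) x i - harness_sum T (noise w) x i|.
    by split.
  move: H; apply/negP; rewrite -ltNge [ltRHS]splitr.
  apply: le_lt_trans (ltrD h1 h2); apply: le_trans (ler_normB _ _).
  by rewrite le_eqVlt; apply/orP; left; apply/eqP; congr `|_|; ring.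
- exact: cvg_cst.
- rewrite -(adde0 0%E); apply: cvgeD => //; first exact: Hm.
  exact: harness_lim_cvg_prob.
Qed.

Let tshift_law T :
  same_law P (fun w => tshift T (noise w) : fieldT) P noise.
Proof.
by apply: (@noise_reindex (fun tx => (tx.1 - T%:Z, tx.2))) => -[t y] [t' y'] [/addIr -> ->].
Qed.

Let measurable_ncvg : measurable (~` [set g : fieldT | harness_cvg g]).
Proof. by apply: measurableC; exact: measurable_harness_cvg. Qed.

Let measurable_tshift T : measurable_fun setT (fun w => tshift T (noise w) : fieldT).
Proof. by apply: measurable_field => t x; case: Hxi => mxi _ _ _ _; exact: mxi. Qed.

(** Under the time shift by [T], which preserves the law, the averaged series becomes the remainder
    after [T] terms by [harness_limE], and this tends to 0 in probability. *)
Lemma avgn_harness_lim_prob x i e : 0 < e ->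
  P [set w | e <= `|avgn T ((harness_lim (noise w))^~ i) x|] @[T --> \oo] --> 0%E.
Proof.
move=> e0.
apply: (@squeeze_cvge _ _ _ _ (fun=> 0%E) _ (fun T =>
    P [set w | e <= `|harness_lim (noise w) x i - harness_sum T (noise w) x i|])).
- apply: nearW => T; rewrite measure_ge0/=.
  pose A := [set g : fieldT | e <= `|avgn T ((harness_lim g)^~ i) x|].
  have mA : measurable A.
    rewrite -[X in measurable X]setTI; apply: (measurable_fun_ler (D := setT)) => //.
    apply: measurableT_comp => //.
    apply: (@measurable_avgn _ _ _ _ _ fieldT T (fun g y => harness_lim g y i)) => y.
    exact: measurable_harness_lim.
  rewrite (_ : [set w | _] = noise @^-1` A)// -(tshift_law T mA).
  set N := (fun w => tshift T (noise w) : fieldT) @^-1` ~` [set g : fieldT | harness_cvg g].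
  have mN : measurable N by rewrite -[X in measurable X]setTI; exact: measurable_tshift.
  rewrite -[leRHS]adde0 -noise_ncvg -(tshift_law T measurable_ncvg) -/N.
  have mlim : measurable [set w |
      e <= `|harness_lim (noise w) x i - harness_sum T (noise w) x i|].
    rewrite -[X in measurable X]setTI; apply: (measurable_fun_ler (D := setT)) => //.
    apply: measurableT_comp => //; apply: measurable_funB.
      exact: (measurableT_comp (measurable_harness_lim x i) measurable_noise).
    exact/Lfun2_measurable/Lfun2_harness_sum.
  apply: le_trans (measureU2 _ mlim mN).
  apply: le_measure; rewrite ?inE.
  + by rewrite -[X in measurable X]setTI; exact: measurable_tshift.
  + exact: measurableU.
  move=> w; rewrite /A /= => ew; apply: contrapT => /not_orP[ne /contrapT cw]; apply: ne.
  by rewrite (harness_limE x i cw) addrAC subrr add0r.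
- exact: cvg_cst.
- exact: harness_lim_cvg_prob.
Qed.

(** This is [harness_limE] for one step: the series of the refreshed noise is its newest term plus
    the average of the series of the old noise. Harmonicity fixes [u] under averaging. *)
Let chain_refresh_lim (u : site d -> 'I_d -> R) w w' :
  (forall i, p_harmonic M p (u^~ i)) -> harness_cvg (noise w) ->
  chain_step M p (limit_conf u (noise w)) (fun x => xi 1 x w') =
  limit_conf u (refresh (w, w')).
Proof.
move=> hu cw; have sumE n x i :
    harness_sum n (tshift 1 (refresh (w, w'))) x i = harness_sum n (noise w) x i.
  by apply: harness_sum_local => t y /andP[_ t0]; rewrite tshift_refresh.
have limE x i : harness_lim (tshift 1 (refresh (w, w'))) x i = harness_lim (noise w) x i.
  by congr (limn _); apply/funext => n; exact: sumE.
have ct : harness_cvg (tshift 1 (refresh (w, w'))).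
  by move=> x i; rewrite (_ : (fun n => _) = fun n => harness_sum n (noise w) x i)//;
    apply/funext => n; exact: sumE.
apply/funext => x; apply/funext => i; rewrite /chain_step /limit_conf (harness_limE x i ct).
rewrite -/(avg M p (fun y => u y i + harness_lim (noise w) y i) x) avgD.
have t0 : harness_term (refresh (w, w')) 0 x i = xi 1 x w' - xi 1 (x - unit_e i) w' by [].
rewrite /harness_sum big_nat1 t0 avgnS.
rewrite (_ : avgn 0 _ = (harness_lim (noise w))^~ i); last by apply/funext => y; exact: limE.
by rewrite (hu i x : avg M p _ x = _); ring.
Qed.

(** By [chain_refresh_lim], one chain step almost surely turns the configuration built from the
    noise into the one built from [refresh], and both fields have the same law. *)
Lemma limit_conf_invariant (u : site d -> 'I_d -> R) (nu : probability (confT R d) R) :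
  (forall i, p_harmonic M p (u^~ i)) ->
  is_law P nu (fun w => limit_conf u (noise w)) -> chain_invariant M p P xi nu.
Proof.
move=> hu lnu B mB.
have mU := measurable_limit_noise u.
have L : same_law P (fun w => limit_conf u (noise w) : confT R d) nu id.
  by move=> A mA; rewrite -lnu.
pose S := (fun z : confT R d * Omega =>
    chain_step M p z.1 (fun x => xi 1 x z.2) : confT R d) @^-1` B.
have mS : measurable S by rewrite -[X in measurable X]setTI; exact: measurable_chain.
pose F eta := P (xsection S eta).
have mF : measurable_fun setT F by exact: measurable_fun_xsection.
have FE eta : P [set w | B (chain_step M p eta (fun x => xi 1 x w))] = F eta.
  by congr (P _); apply/seteqP; split => w; rewrite /xsection /= inE.
under eq_integral do rewrite FE.
rewrite -(same_law_ge0_integral mU _ L mF (fun _ => measure_ge0 _ _)) //.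
pose G := (fun g : fieldT => limit_conf u g : confT R d) @^-1` B.
have mG : measurable G by rewrite -[X in measurable X]setTI; exact: measurable_limit_conf.
rewrite lnu// -[LHS]/(P (noise @^-1` G)) -(refresh_law mG) /=.
have mRG : measurable (refresh @^-1` G).
  by rewrite -[X in measurable X]setTI; exact: measurable_glue.
apply: ge0_ae_eq_integral => //.
- exact: measurable_fun_xsection.
- exact: (measurableT_comp mF).
have mN : measurable (noise @^-1` ~` [set g : fieldT | harness_cvg g]).
  by rewrite -[X in measurable X]setTI; apply: measurable_noise.
exists (noise @^-1` ~` [set g : fieldT | harness_cvg g]); split => //; first exact: noise_ncvg.
move=> w /=; apply: contra_not => cw _; rewrite -FE; congr (P _).
by apply/seteqP; split => w'; rewrite /xsection /= inE chain_refresh_lim.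
Qed.

(** As [u] is harmonic, under [nu] the T-fold average minus [u] is the T-fold average of the series
    and tends to 0 in probability. Domination carries this over to [mu], at the cost of a factor
    1/b, and [invariant_limit] identifies [mu]. *)
Lemma invariant_dominated (u : site d -> 'I_d -> R) (nu mu : probability (confT R d) R) (b : R) :
  (forall i, p_harmonic M p (u^~ i)) ->
  is_law P nu (fun w => limit_conf u (noise w)) ->
  chain_invariant M p P xi mu -> 0 < b ->
  (forall B, measurable B -> (b%:E * mu B <= nu B)%E) ->
  forall B, measurable B -> mu B = nu B.
Proof.
move=> hu lnu imu b0 mnu B mB; rewrite lnu//.
apply: (invariant_limit imu) => // x i e e0.
have mE T : measurable [set eta : confT R d | e <= `|avgn T (eta^~ i) x - u x i|].
  rewrite -[X in measurable X]setTI; apply: (measurable_fun_ler (D := setT)) => //.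
  apply: measurableT_comp => //; apply: measurable_funB => //.
  apply: (@measurable_avgn _ _ _ _ _ (confT R d) T (fun z y => z y i)) => y.
  exact: measurable_conf_coord.
apply: (@squeeze_cvge _ _ _ _ (fun=> 0%E) _ (fun T =>
    (b^-1)%:E * P [set w | (e <= `|avgn T ((harness_lim (noise w))^~ i) x|)%R])%E).
- apply: nearW => T; rewrite measure_ge0/= lee_pdivlMl//.
  apply: le_trans (mnu _ (mE T)) _; rewrite lnu// le_eqVlt; apply/orP; left; apply/eqP.
  congr (P _); apply/seteqP; split => w /=;
  by rewrite /limit_conf avgnD (avgn_harmonic T (hu i)) addrAC subrr add0r.
- exact: cvg_cst.
- rewrite -(mule0 (b^-1)%:E); apply: cvgeM => //; last exact: avgn_harness_lim_prob.
  exact: cvg_cst.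
Qed.

(** A convex combination dominates b mu1 and (1 - b) mu2, so [invariant_dominated] applies to each
    component. *)
Lemma limit_conf_extreme (u : site d -> 'I_d -> R) (nu : probability (confT R d) R) :
  (forall i, p_harmonic M p (u^~ i)) ->
  is_law P nu (fun w => limit_conf u (noise w)) -> extreme_invariant M p P xi nu.
Proof.
move=> hu lnu; split; first exact: limit_conf_invariant lnu.
move=> b mu1 mu2 /andP[b0 b1] i1 i2 nuE B mB; split.
- apply: (invariant_dominated hu lnu i1 b0) => // A mA; rewrite nuE// leeDl// mule_ge0//.
  by rewrite lee_fin subr_ge0 ltW.
- apply: (invariant_dominated hu lnu i2 (b := 1 - b)) => //; first by rewrite subr_gt0.
  by move=> A mA; rewrite nuE// leeDr// mule_ge0// lee_fin ltW.
Qed.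

(** The part [u] is deterministic and does not affect the variance. *)
Lemma variance_limit_conf (u : site d -> 'I_d -> R) (nu : probability (confT R d) R) x i :
  is_law P nu (fun w => limit_conf u (noise w)) ->
  variance nu (eta_coord x i) = variance P (fun w => harness_lim (noise w) x i).
Proof.
move=> lnu; have mU := measurable_limit_noise u.
have L : same_law P (fun w => limit_conf u (noise w) : confT R d) nu id.
  by move=> A mA; rewrite -lnu.
have l2 := Lfun2_harness_lim x i.
rewrite -(varianceD_cst_l (u x i) l2).
have mc := measurable_conf_coord (R := R) x i.
have i1 : P.-integrable setT (fun w => (limit_conf u (noise w) x i)%:E).
  by apply/Lfun1_integrable/Lfun2_Lfun1/Lfun2D => //; exact: Lfun_cst.
have E1 : expectation nu (eta_coord x i) = expectation P (fun w => limit_conf u (noise w) x i).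
  rewrite unlock; symmetry.
  apply: (same_law_integral mU _ L (F := fun eta : confT R d => (eta x i)%:E)) => //.
  exact/measurable_EFinP.
rewrite /variance unlock E1 unlock; symmetry.
apply: (same_law_ge0_integral mU _ L (F := fun eta : confT R d =>
  ((eta x i - mean P (fun w => limit_conf u (noise w) x i)) *
   (eta x i - mean P (fun w => limit_conf u (noise w) x i)))%:E)) => //.
- by apply/measurable_EFinP; apply: measurable_funM; apply: measurable_funB.
- by move=> eta; rewrite lee_fin -expr2 sqr_ge0.
Qed.

(** The second moment bounds the variance, which avoids computing the mean of the series. *)
Lemma variance_harness_lim_le x i :
  (variance P (fun w => harness_lim (noise w) x i) <= (totvar x i)%:E)%E.
Proof.
have l2 := Lfun2_harness_lim x i.
rewrite varianceE// (le_trans _ (harness_lim_sqr_le x i))//.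
by rewrite [in leLHS]unlock geeDl// oppe_le0 sqre_ge0.
Qed.

(** * Variances of invariant laws with finite second moments *)

Section StationaryMoments.
Variable nu : probability (confT R d) R.
Hypotheses (inv : chain_invariant M p P xi nu)
  (nu2 : forall x i, nu.-integrable setT (EFin \o eta_coord x i) /\
                     nu.-integrable setT (fun eta => (eta_coord x i eta ^+ 2)%:E)).
Let m x i := mean nu (fun eta => eta x i).

Let L2nu x i : (fun eta : confT R d => eta x i) \in Lfun nu 2%:E.
Proof. by apply/Lfun2P; split; [exact: measurable_conf_coord|case: (nu2 x i)]. Qed.

(** The variance is computed along the flow, whose law is [nu]. For fixed [eta] the partial sum is
    centred with second moment [sumvar T x i], so the cross term vanishes in the inner integral over
    the noise. *)
Lemma variance_decomposition T x i : variance nu (eta_coord x i) =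
  (\int[nu]_eta ((avgn T (eta^~ i) x - m x i) ^+ 2)%:E + (sumvar T x i)%:E)%E.
Proof.
have mc := measurable_conf_coord (R := R) x i.
have mf : measurable_fun setT (fun eta : confT R d => ((eta x i - m x i) ^+ 2)%:E).
  by apply/measurable_EFinP/measurable_funX/measurable_funB.
have -> : variance nu (eta_coord x i) = (\int[nu]_eta ((eta x i - m x i) ^+ 2)%:E)%E.
  by rewrite /variance unlock unlock; apply: eq_integral => eta _; rewrite expr2.
rewrite -(same_law_ge0_integral (measurable_flow T) _ (flow_law inv T) mf)//; last first.
  by move=> eta; rewrite lee_fin sqr_ge0.
rewrite fubini_tonelli1//; last 2 first.
- exact: (measurableT_comp mf (measurable_flow T)).
- by move=> z; rewrite lee_fin sqr_ge0.
rewrite -[X in (_ + X)%E]mule1 -(probability_setT nu) -integral_cst// -ge0_integralD//.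
- apply: eq_integral => eta _; rewrite /fubini_F /flow /=.
  set c := avgn T (eta^~ i) x - m x i.
  have Dl2 := Lfun2_harness_sum T x i.
  rewrite -mean_harness_sum_sqr -EFinD.
  under eq_integral do rewrite addrAC -/c.
  rewrite mean_EFin; last by apply: Lfun2X; apply: Lfun2D => //; exact: Lfun_cst.
  rewrite (mean_sqrD (Lfun_cst _ c _) Dl2); last first.
    by rewrite meanZ ?Lfun2_Lfun1// mean_harness_sum mulr0.
  by congr (_ + _)%:E; exact: (mean_cst P (c ^+ 2)).
- by move=> eta _; rewrite lee_fin sqr_ge0.
- apply/measurable_EFinP/measurable_funX/measurable_funB => //.
  apply: (@measurable_avgn _ _ _ _ _ (confT R d) T (fun z y => z y i)) => y.
  exact: measurable_conf_coord.
- by move=> eta _; rewrite lee_fin sumr_ge0.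
Qed.

Lemma totvar_le_variance x i : ((totvar x i)%:E <= variance nu (eta_coord x i))%E.
Proof.
have cs : (fun n => (sumvar n x i)%:E) @ \oo --> (totvar x i)%:E.
  by apply: cvg_EFin; [exact: nearW|exact: sumvar_cvg].
rewrite -(cvg_lim _ cs)//; apply: lime_le; first exact: cvgP cs.
apply: nearW => T; rewrite (variance_decomposition T) leeDr// integral_ge0// => eta _.
by rewrite lee_fin sqr_ge0.
Qed.

(** One step of the flow preserves [nu] and its noise part is centred, so taking means leaves the
    average of [m]. *)
Lemma mean_harmonic i : p_harmonic M p (m^~ i).
Proof.
move=> x; rewrite -/(avg M p (m^~ i) x) -[avg M p _ x]/(avgn 1 (m^~ i) x).
rewrite -mean_avgn; last by move=> y; exact: L2nu.
have mc := measurable_conf_coord (R := R) x i.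
have mcE : measurable_fun setT (fun eta : confT R d => (eta x i)%:E) by exact/measurable_EFinP.
have L := flow_law inv 1.
have L' : same_law nu id (nu \x P)%E (fun z => flow 1 z.1 (noise z.2) : confT R d).
  by move=> A mA; rewrite L.
have mid : measurable_fun setT (id : confT R d -> confT R d) by exact: measurable_id.
have i1 : nu.-integrable setT (fun eta : confT R d => (eta x i)%:E).
  by case: (nu2 x i).
rewrite /m /mean (same_law_integral mid (measurable_flow 1) L' mcE i1).
have i2 := same_law_integrable mid (measurable_flow 1) L' mcE i1.
rewrite -(integral12_prod_meas1 i2) /fubini_F /=; congr fine.
apply: eq_integral => eta _; rewrite /flow.
rewrite mean_EFin; last first.
  by apply/Lfun2_Lfun1/Lfun2D; [exact: Lfun_cst|exact: Lfun2_harness_sum].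
rewrite (meanD (f := fun=> avgn 1 (eta^~ i) x)); last 2 first.
- exact: Lfun_cst.
- exact/Lfun2_Lfun1/Lfun2_harness_sum.
by rewrite mean_harness_sum addr0 mean_cst.
Qed.

(** With variance at most [totvar], the decomposition leaves at most totvar - sumvar T for the
    second moment of the averaged deviation. This tends to 0, and Chebyshev's inequality gives the
    convergence that [invariant_limit] requires. *)
Lemma minimal_variance_law :
  (forall x i, (variance nu (eta_coord x i) <= (totvar x i)%:E)%E) ->
  is_law P nu (fun w => limit_conf m (noise w)).
Proof.
move=> Vle; apply: invariant_limit => // x i e e0.
have e20 : 0 < e ^+ 2 by rewrite exprn_gt0.
apply: (@squeeze_cvge _ _ _ _ (fun=> 0%E) _
    (fun T => ((e ^+ 2)^-1 * (totvar x i - sumvar T x i))%:E)).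
- apply: nearW => T; rewrite measure_ge0/= EFinM lee_pdivlMl//.
  apply: le_trans (chebyshev_bound nu _ e0) _.
    apply: measurable_funB => //.
    apply: (@measurable_avgn _ _ _ _ _ (confT R d) T (fun z y => z y i)) => y.
    exact: measurable_conf_coord.
  by rewrite EFinB leeBrDr// -variance_decomposition.
- exact: cvg_cst.
- apply: cvg_EFin; first exact: nearW.
  rewrite -(mulr0 (e ^+ 2)^-1) -(subrr (totvar x i)) /comp/=.
  apply: cvgM; first exact: cvg_cst.
  by apply: cvgB; [exact: cvg_cst|exact: sumvar_cvg].
Qed.

End StationaryMoments.

End Noise.

Theorem theorem2p3 (R : realType) (d : nat) (M : nat) (p : site d -> R)
  (dO : measure_display) (Omega : measurableType dO) (P : probability Omega R)
  (xi : int -> site d -> Omega -> R) :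
  is_kernel M p -> strongly_aperiodic p -> iid_noise P xi ->
  (forall u : 'I_d -> site d -> R, (forall i, p_harmonic M p (u i)) ->
     exists pi_u : probability (confT R d) R,
       is_law P pi_u (Xconf M p xi u) /\ extreme_invariant M p P xi pi_u) /\
  (forall pi0 : probability (confT R d) R,
     is_law P pi0 (Xconf M p xi (fun _ _ => 0)) ->
   forall nu : probability (confT R d) R, chain_invariant M p P xi nu ->
     (forall x i, nu.-integrable setT (EFin \o eta_coord x i) /\
                  nu.-integrable setT (fun eta => (eta_coord x i eta ^+ 2)%:E)) ->
     (forall x i, (variance pi0 (eta_coord x i) <= variance nu (eta_coord x i))%E) /\
     ((forall x i, variance nu (eta_coord x i) = variance pi0 (eta_coord x i)) <->
      exists u : 'I_d -> site d -> R,
        (forall i, p_harmonic M p (u i)) /\ is_law P nu (Xconf M p xi u))).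
Proof.
move=> Hp Hap Hxi; split=> [u hu|pi0 lpi0 nu inv nu2].
  have lu : is_law P (image_law P (measurable_limit_noise M p Hxi (fun x i => u i x)))
      (fun w => limit_conf M p (fun x i => u i x) (noise xi w)) by [].
  eexists; split; last exact: limit_conf_extreme lu.
  by rewrite XconfE.
rewrite XconfE in lpi0.
(* The constant [totvar] separates the two variances: it is at least that of [pi0] and at most that
   of [nu]. Equality therefore puts the variance of [nu] below [totvar]. *)
have V0 x i : (variance pi0 (eta_coord x i) <= (totvar M p P xi x i)%:E)%E.
  by rewrite (variance_limit_conf Hp Hap Hxi _ _ lpi0); exact: variance_harness_lim_le.
split=> [x i|]; first by apply: le_trans (V0 x i) _; exact: totvar_le_variance.
split=> [Veq|[u [hu lu]] x i].
  (* The means under [nu] are the harmonic witness. *)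
  exists (fun i x => mean nu (fun eta => eta x i)); split=> [i|].
    exact: (mean_harmonic Hxi inv nu2).
  rewrite XconfE; apply: minimal_variance_law => // x i.
  by rewrite Veq.
rewrite XconfE in lu.
by rewrite (variance_limit_conf Hp Hap Hxi _ _ lpi0) (variance_limit_conf Hp Hap Hxi _ _ lu).
Qed.
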